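(* Let $\alpha>0$, let $Q=I\times B$ be an $\alpha$-parabolic cylinder of radius $r$, let $\rho\in L^1(Q)$ with $\rho\ge0$ and $\|\rho\|_\infty\le c_0|Q|^{-1}\|\rho\|_1$, and let $a\in L^1(I;W^{1,1}(B))$. Then $$\frac1{|Q|}\int_Q\Big|\frac{a-\langle a\rangle_\rho}{r}\Big|\,dz\le c\,\frac1{|Q|}\int_Q|\nabla a|\,dz+c\,\alpha\,\mathcal{N}_Q(\partial_t a),$$ with $c$ depending only on $m$ and $c_0$.
   Context: An $\alpha$-parabolic cylinder of radius $r$ is $Q=(t_0-\alpha r^2,t_0+\alpha r^2)\times B_r(x_0)$; $\nabla$ is the spatial gradient. $\langle a\rangle_\rho:=\frac1{\|\rho\|_1}\int_Q a\rho\,dz$. $\mathcal{F}_Q:=\{\xi\in C^\infty_0(Q):\|\xi\|_\infty+r\|\nabla\xi\|_\infty+\alpha r^2\|\partial_t\xi\|_\infty\le1\}$ and for a distribution $b\in\mathcal{D}'(Q)$, $\mathcal{N}_Q(b):=\sup_{\xi\in\mathcal{F}_Q}r|Q|^{-1}|\langle b,\xi\rangle|$ (possibly $+\infty$); here $\langle\partial_t a,\xi\rangle=-\int_Q a\,\partial_t\xi$. *)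

(* Defs.v *)
From HB Require Import structures.
From mathcomp Require Import all_boot all_order all_algebra.
From mathcomp Require Import all_classical all_reals all_analysis.
Set Implicit Arguments. Unset Strict Implicit. Unset Printing Implicit Defensive.
Import Order.TTheory GRing.Theory Num.Theory.
Import numFieldNormedType.Exports.
Local Open Scope classical_set_scope.
Local Open Scope ring_scope.

(* Euclidean space R^(k+1), realized as nested pairs R * (R * ( ... * R)),
   equipped with the product sigma-algebra of Borel sets. *)
Fixpoint Rmeas (R : realType) (k : nat) : {d : measure_display & measurableType d} :=
  match k with
  | 0 => existT (fun d => measurableType d) _ (measurableTypeR R)
  | k'.+1 => existT (fun d => measurableType d) _ ((measurableTypeR R * projT2 (Rmeas R k'))%type : measurableType _)
  end.

Definition car (R : realType) (k : nat) : measurableType (projT1 (Rmeas R k)) :=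
  projT2 (Rmeas R k).

Fixpoint leb (R : realType) (k : nat) : {measure set (car R k) -> \bar R} :=
  match k return {measure set (car R k) -> \bar R} with
  | 0 => @lebesgue_measure R
  | k'.+1 => ((@lebesgue_measure R) \x^ (leb R k'))%E
  end.

Fixpoint zerov (R : realType) (k : nat) : car R k :=
  match k return car R k with
  | 0 => (0 : R)
  | k'.+1 => ((0 : R), zerov R k')
  end.

Fixpoint addv (R : realType) (k : nat) : car R k -> car R k -> car R k :=
  match k return car R k -> car R k -> car R k with
  | 0 => fun x y : R => x + y
  | k'.+1 => fun x y => ((x.1 + y.1 : R), addv x.2 y.2)
  end.

Fixpoint scalev (R : realType) (k : nat) (s : R) : car R k -> car R k :=
  match k return car R k -> car R k with
  | 0 => fun x : R => s * x
  | k'.+1 => fun x => ((s * x.1 : R), scalev s x.2)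
  end.

Definition subv (R : realType) (k : nat) (x y : car R k) : car R k :=
  addv x (scalev (-1) y).

Fixpoint dotv (R : realType) (k : nat) : car R k -> car R k -> R :=
  match k return car R k -> car R k -> R with
  | 0 => fun x y : R => x * y
  | k'.+1 => fun x y => (x.1 : R) * y.1 + dotv x.2 y.2
  end.

Definition enorm (R : realType) (k : nat) (x : car R k) : R := Num.sqrt (dotv x x).

Definition dirder (R : realType) (k : nat) (f : car R k -> R) (z v : car R k) : R :=
  derive1 (fun s : R => f (addv z (scalev s v))) 0.
Definition dirderivable (R : realType) (k : nat) (f : car R k -> R) (z v : car R k) : Prop :=
  derivable (fun s : R => f (addv z (scalev s v))) 0 1.

Fixpoint iterD (R : realType) (k : nat) (vs : seq (car R k)) (f : car R k -> R) : car R k -> R :=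
  match vs with
  | [::] => f
  | v :: vs' => fun z => dirder (iterD vs' f) z v
  end.

Definition econt (R : realType) (k : nat) (g : car R k -> R) : Prop :=
  forall z (eps : R), 0 < eps -> exists2 del : R, 0 < del &
    forall w, enorm (subv w z) < del -> `|g w - g z| < eps.

Definition smooth (R : realType) (k : nat) (f : car R k -> R) : Prop :=
  forall vs : seq (car R k),
    econt (iterD vs f) /\ forall z v, dirderivable (iterD vs f) z v.

Definition eclosed (R : realType) (k : nat) (K : set (car R k)) : Prop :=
  forall z, (forall eps : R, 0 < eps -> exists2 w, K w & enorm (subv w z) < eps) -> K z.
Definition ebounded (R : realType) (k : nat) (K : set (car R k)) : Prop :=
  exists M : R, forall z, K z -> enorm z <= M.

Definition compact_support_in (R : realType) (k : nat) (D : set (car R k)) (f : car R k -> R) : Prop :=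
  exists K : set (car R k), [/\ eclosed K, ebounded K, K `<=` D & forall z, ~ K z -> f z = 0].

Definition Cc_infty (R : realType) (k : nat) (D : set (car R k)) (f : car R k -> R) : Prop :=
  smooth f /\ compact_support_in D f.

(* Space-time R x R^(k+1) = car R k.+1, points z = (t, x) with z.1 = t, z.2 = x.
   Spatial dimension m = k+1. *)

Definition pcyl (R : realType) (k : nat) (alpha r t0 : R) (x0 : car R k) : set (car R k.+1) :=
  [set z | t0 - alpha * r ^+ 2 < (z.1 : R) < t0 + alpha * r ^+ 2 /\ enorm (subv z.2 x0) < r].

Definition dt (R : realType) (k : nat) (f : car R k.+1 -> R) (z : car R k.+1) : R :=
  dirder f z ((1 : R), zerov R k).

Fixpoint gradof (R : realType) (k : nat) : (car R k -> R) -> car R k :=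
  match k return (car R k -> R) -> car R k with
  | 0 => fun D => D (1 : R)
  | k'.+1 => fun D => (D ((1 : R), zerov R k'), gradof (fun v => D ((0 : R), v)))
  end.

Definition gradx (R : realType) (k : nat) (f : car R k.+1 -> R) (z : car R k.+1) : car R k :=
  gradof (fun v : car R k => dirder f z ((0 : R), v)).

Definition supn (R : realType) (k : nat) (g : car R k -> R) : \bar R :=
  ereal_sup [set (`|g z|)%:E | z in [set: car R k]].

Definition FQ (R : realType) (k : nat) (alpha r t0 : R) (x0 : car R k) (xi : car R k.+1 -> R) : Prop :=
  Cc_infty (pcyl alpha r t0 x0) xi /\
  (supn xi + (r%:E * supn (fun z => enorm (gradx xi z)))
     + ((alpha * r ^+ 2)%:E * supn (dt xi)) <= 1)%E.

(* |Q| (as a real number; Q is bounded open nonempty so its measure is finite) *)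
Definition volQ (R : realType) (k : nat) (alpha r t0 : R) (x0 : car R k) : R :=
  fine (leb R k.+1 (pcyl alpha r t0 x0)).

(* N_Q(partial_t a) = sup_{xi in F_Q} r |Q|^-1 |<partial_t a, xi>|,
   where <partial_t a, xi> = - int_Q a partial_t xi *)
Definition NQ_dt (R : realType) (k : nat) (alpha r t0 : R) (x0 : car R k) (a : car R k.+1 -> R) : \bar R :=
  ereal_sup [set ((r / volQ alpha r t0 x0)%:E *
                  `| - (\int[leb R k.+1]_(z in pcyl alpha r t0 x0) (a z * dt xi z)%:E) |)%E
            | xi in FQ alpha r t0 x0].

Definition weak_gradx (R : realType) (k : nat) (D : set (car R k.+1))
    (a : car R k.+1 -> R) (g : car R k.+1 -> car R k) : Prop :=
  (forall v : car R k, measurable_fun D (fun z => dotv (g z) v)) /\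
  (leb R k.+1).-integrable D (fun z => (enorm (g z))%:E) /\
  forall (phi : car R k.+1 -> R) (v : car R k), Cc_infty D phi ->
    (\int[leb R k.+1]_(z in D) (a z * dirder phi z ((0 : R), v))%:E
     = - \int[leb R k.+1]_(z in D) (dotv (g z) v * phi z)%:E)%E.

Definition wmean (R : realType) (k : nat) (D : set (car R k.+1)) (rho a : car R k.+1 -> R) : R :=
  fine (\int[leb R k.+1]_(z in D) (a z * rho z)%:E) / fine (\int[leb R k.+1]_(z in D) (rho z)%:E).

(* Main.v *)
Require Import Defs.
From HB Require Import structures.
From mathcomp Require Import all_boot all_order all_algebra.
From mathcomp Require Import all_classical all_reals all_analysis.
From mathcomp Require Import measurable_realfun ring lra.
Import Defs.
Import Order.TTheory GRing.Theory Num.Theory.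
Import numFieldNormedType.Exports.
Local Open Scope classical_set_scope.
Local Open Scope ring_scope.
Set Implicit Arguments. Unset Strict Implicit. Unset Printing Implicit Defensive.

(* Write [m = k.+1] for the spatial dimension, [Q = I x B] and [G = int_Q |g|].

   Space.  Fix [w] in [B] and a test function [h].  For [s >= 1] the functions
   [s^m h(t, w + s (x - w))] are still test functions in [Q] because [B] is
   convex, and the [s]-derivative of such a function is [s^(m-1)] times the value
   at [(t, w + s (x - w))] of [grad h . (x - w) + m h], which is also the spatial
   divergence of [h(t, w + s (x - w)) (x - w)].  Pairing with [a], using the weak
   gradient and the mean value theorem between [s = 1] and [s = 2] gives by duality
     int_Q |a(t,x) - a(t,(x+w)/2)| <= 2^m r G.
   The midpoint is symmetric in [x] and [w], so integrating over [w] bounds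
   int_I int_B int_B |a(t,x) - a(t,w)|, hence the distance in [L^1(Q)] of [a] to
   its weighted spatial mean [A(t) = int_B a(t,w) eta(w) dw].

   Time.  Let [theta] be a bump of integral one in [I] and [C = int_I A theta].
   For a test function [h] on [I], [psi = h - (int h) theta] has integral zero, so its
   primitive [phi] is a test function and [phi(t) eta(x)] is a multiple of an element
   of [F_Q]; thus [int_I (A - C) h = int_I A psi] is controlled by [N_Q], and
   duality bounds [int_I |A - C|].

   Weight.  For every constant [C], [int_Q |a - <a>_rho| <= (1 + |c0|) int_Q |a - C|].

   Duality needs the sign of an integrable function to be a weighted [L^1] limit of
   test functions: the sets whose indicator is such a limit form a sigma-algebra
   which contains the half-spaces. *)

(** * Vector algebra *)

Section vector_algebra.
Context {R : realType}.
Implicit Types k : nat.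

Lemma dotvC k (x y : car R k) : dotv x y = dotv y x.
Proof.
elim: k x y => [|k IH] x y /=; first exact: mulrC.
by rewrite mulrC IH.
Qed.

Lemma dotvDl k (x y z : car R k) : dotv (addv x y) z = dotv x z + dotv y z.
Proof.
elim: k x y z => [|k IH] x y z /=; first exact: mulrDl.
by rewrite IH mulrDl addrACA.
Qed.

Lemma dotvZl k s (x z : car R k) : dotv (scalev s x) z = s * dotv x z.
Proof.
elim: k x z => [|k IH] x z /=; first by rewrite mulrA.
by rewrite IH mulrDr mulrA.
Qed.

Lemma dotvDr k (x y z : car R k) : dotv z (addv x y) = dotv z x + dotv z y.
Proof. by rewrite dotvC dotvDl !(dotvC z). Qed.

Lemma dotvZr k s (x z : car R k) : dotv z (scalev s x) = s * dotv z x.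
Proof. by rewrite dotvC dotvZl dotvC. Qed.

Lemma dotvBl k (x y z : car R k) : dotv (subv x y) z = dotv x z - dotv y z.
Proof. by rewrite /subv dotvDl dotvZl mulN1r. Qed.

Lemma dotvBr k (x y z : car R k) : dotv z (subv x y) = dotv z x - dotv z y.
Proof. by rewrite !(dotvC z) dotvBl. Qed.

Lemma dotv0l k (x : car R k) : dotv (zerov R k) x = 0.
Proof. by elim: k x => [|k IH] x /=; rewrite mul0r// IH addr0. Qed.

Lemma dotv0r k (x : car R k) : dotv x (zerov R k) = 0.
Proof. by rewrite dotvC dotv0l. Qed.

Definition dotvE := (dotvDl, dotvDr, dotvZl, dotvZr, dotvBl, dotvBr, dotv0l, dotv0r).

Lemma dotv_ge0 k (x : car R k) : 0 <= dotv x x.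
Proof.
elim: k x => [|k IH] x /=; first by rewrite -expr2 sqr_ge0.
by rewrite addr_ge0// -expr2 sqr_ge0.
Qed.

Lemma dotv_ext k (x y : car R k) : (forall v, dotv x v = dotv y v) -> x = y.
Proof.
elim: k x y => [|k IH] x y /= xy; first by have := xy 1; rewrite !mulr1.
case: x y xy => [x1 x2] [y1 y2] /= xy; congr pair.
  by have := xy (1, zerov R k); rewrite /= !mulr1 !dotv0r !addr0.
by apply: IH => v; have := xy (0, v); rewrite /= !mulr0 !add0r.
Qed.

Lemma addv0 k (x : car R k) : addv x (zerov R k) = x.
Proof. by apply: dotv_ext => v; rewrite !dotvE addr0. Qed.

Lemma scale0v k (x : car R k) : scalev 0 x = zerov R k.
Proof. by apply: dotv_ext => v; rewrite !dotvE mul0r. Qed.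

Lemma scalev0 k s : scalev s (zerov R k) = zerov R k.
Proof. by apply: dotv_ext => v; rewrite !dotvE mulr0. Qed.

Lemma gradof_dotv k (p : car R k) : gradof (dotv p) = p.
Proof.
elim: k p => [|k IH] p /=; first by rewrite mulr1.
case: p => p1 p2 /=; congr pair; first by rewrite mulr1 dotv0r addr0.
rewrite -[RHS]IH; congr gradof; apply/funext => v.
by rewrite mulr0 add0r.
Qed.

(* Meaningful for [i <= k] only. *)
Fixpoint basisv k (i : nat) : car R k :=
  match k return car R k with
  | 0 => (1 : R)
  | k'.+1 => if i is i'.+1 then ((0 : R), basisv k' i') else ((1 : R), zerov R k')
  end.

Lemma sum_dotv_basisv k (x y : car R k) :
  \sum_(i < k.+1) dotv x (basisv k i) * dotv y (basisv k i) = dotv x y.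
Proof.
elim: k x y => [|k IH] x y; first by rewrite big_ord1 /= !mulr1.
rewrite big_ord_recl /= !mulr1 !dotv0r !addr0 -IH; congr +%R.
by apply: eq_bigr => i _; rewrite !mulr0 !add0r.
Qed.

Lemma dotv_basisv k (i : 'I_k.+1) : dotv (basisv k i) (basisv k i) = 1.
Proof.
elim: k i => [|k IH] i; first by rewrite /= mulr1.
case: i => -[|i] ltik /=; first by rewrite mulr1 dotv0l addr0.
by rewrite mulr0 add0r -[RHS](IH (Ordinal (ltik : (i < k.+1)%N))).
Qed.

Lemma enorm_ge0 k (x : car R k) : 0 <= enorm x.
Proof. exact: sqrtr_ge0. Qed.

Lemma sqr_enorm k (x : car R k) : enorm x ^+ 2 = dotv x x.
Proof. by rewrite sqr_sqrtr// dotv_ge0. Qed.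

Lemma enorm_lt k (x : car R k) (r : R) : 0 < r -> (enorm x < r) = (dotv x x < r ^+ 2).
Proof. by move=> r0; rewrite -sqr_enorm ltr_sqr ?nnegrE ?enorm_ge0 ?ltW. Qed.

Lemma dotv_sqr_le k (x y : car R k) : dotv x y ^+ 2 <= dotv x x * dotv y y.
Proof.
have comb_ge0 s t : 0 <= s ^+ 2 * dotv x x + 2 * s * t * dotv x y + t ^+ 2 * dotv y y.
  have := dotv_ge0 (addv (scalev s x) (scalev t y)).
  by rewrite !dotvE (dotvC y x); lra.
have [y0|y_neq0] := eqVneq (dotv y y) 0.
  have := comb_ge0 (dotv x y) (- (dotv x x + 1)); have := dotv_ge0 x.
  by rewrite y0; nra.
have y_gt0 : 0 < dotv y y by rewrite lt0r y_neq0 dotv_ge0.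
rewrite -subr_ge0 -(pmulr_rge0 _ y_gt0).
by have := comb_ge0 (dotv y y) (- dotv x y); lra.
Qed.

Lemma normr_dotv_le k (x y : car R k) : `|dotv x y| <= enorm x * enorm y.
Proof.
rewrite -ler_sqr ?nnegrE ?mulr_ge0 ?enorm_ge0//.
by rewrite exprMn !sqr_enorm real_normK ?num_real// dotv_sqr_le.
Qed.

Lemma enormZ k s (x : car R k) : enorm (scalev s x) = `|s| * enorm x.
Proof. by rewrite /enorm !dotvE mulrA -expr2 sqrtrM ?sqr_ge0// sqrtr_sqr. Qed.

Lemma ler_enormD k (x y : car R k) : enorm (addv x y) <= enorm x + enorm y.
Proof.
rewrite -ler_sqr ?nnegrE ?addr_ge0 ?enorm_ge0//.
rewrite sqr_enorm !dotvE (dotvC y x) sqrrD !sqr_enorm.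
have := le_trans (ler_norm _) (normr_dotv_le x y).
lra.
Qed.

Lemma ler_enormB k (x y : car R k) : enorm (subv x y) <= enorm x + enorm y.
Proof. by rewrite (le_trans (ler_enormD _ _))// enormZ normrN1 mul1r. Qed.

Lemma enorm0E (x : car R 0) : enorm x = `|(x : R)|.
Proof. by rewrite /enorm/= -expr2 sqrtr_sqr. Qed.

Lemma ler_enorm_fst k (x : car R k.+1) : `|(x.1 : R)| <= enorm x.
Proof. by rewrite -sqrtr_sqr ler_wsqrtr//= expr2 lerDl dotv_ge0. Qed.

Lemma ler_enorm_snd k (x : car R k.+1) : enorm (x.2 : car R k) <= enorm x.
Proof. by rewrite ler_wsqrtr//= lerDr -expr2 sqr_ge0. Qed.

Lemma enorm_pair_le k (x : car R k.+1) : enorm x <= `|(x.1 : R)| + enorm (x.2 : car R k).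
Proof.
rewrite -ler_sqr ?nnegrE ?addr_ge0 ?enorm_ge0// sqr_enorm sqrrD sqr_enorm /=.
by rewrite real_normK ?num_real// expr2 addrAC lerDl mulrn_wge0// mulr_ge0 ?enorm_ge0.
Qed.

End vector_algebra.

(** * Smooth functions *)

Section tame_functions.
Context {R : realType}.
Implicit Types k : nat.

Definition enbhs k (z : car R k) : set_system (car R k) :=
  filter_from [set e : R | 0 < e] (fun e => [set w | enorm (subv w z) < e]).

Global Instance enbhs_filter k (z : car R k) : Filter (enbhs z).
Proof.
apply: filter_from_filter; first by exists 1 => /=.
move=> d e d0 e0; exists (Num.min d e); first by rewrite /= lt_min d0.
by move=> w /=; rewrite lt_min => /andP[].
Qed.

Lemma econtP k (f : car R k -> R) : econt f <-> forall z, f w @[w --> enbhs z] --> f z.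
Proof.
split=> [cf z|cf z e e0].
  apply/cvgrPdist_lt => e /(cf z)[d d0 df]; exists d => // w /df.
  by rewrite distrC.
have /cvgrPdist_lt/(_ _ e0)[d d0 df] := cf z.
by exists d => // w /df; rewrite distrC.
Qed.

Definition deriv_seq (F : nat -> R -> R) : Prop :=
  forall n x, is_derive x (1 : R) (F n) (F n.+1 x).

(* A class of smooth functions which is closed under directional derivatives,
   so that smoothness is obtained by induction, without a Leibniz formula for
   iterated derivatives. *)
Inductive tame k : (car R k -> R) -> Prop :=
| tame_cst (c : R) : tame (fun=> c)
| tame_dotv v : tame (fun z => dotv z v)
| tameD f g : tame f -> tame g -> tame (fun z => f z + g z)
| tameM f g : tame f -> tame g -> tame (fun z => f z * g z)
| tame_comp F f : deriv_seq F -> tame f -> tame (fun z => F 0%N (f z)).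

Lemma deriv_seq_continuous F n : deriv_seq F -> continuous (F n).
Proof.
move=> dF x; apply: differentiable_continuous; apply/derivable1_diffP.
by have [] := dF n x.
Qed.

Lemma tameZ k c (f : car R k -> R) : tame f -> tame (fun z => c * f z).
Proof. by apply: tameM; exact: tame_cst. Qed.

Lemma tameB k (f g : car R k -> R) : tame f -> tame g -> tame (fun z => f z - g z).
Proof.
move=> tf tg; under eq_fun do rewrite -mulN1r.
by apply: tameD => //; exact: tameZ.
Qed.

Lemma tame_sum k (n : nat) (f : 'I_n -> car R k -> R) :
  (forall i, tame (f i)) -> tame (fun z => \sum_(i < n) f i z).
Proof.
elim: n f => [|n IH] f tf.
  by under eq_fun do rewrite big_ord0; exact: tame_cst.
under eq_fun do rewrite big_ord_recl.
by apply: tameD => //; exact: IH.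
Qed.

Lemma tame_precomp j k (L : car R j -> car R k) (f : car R k -> R) :
  (forall v, tame (fun z => dotv (L z) v)) -> tame f -> tame (fun z => f (L z)).
Proof.
move=> tL; elim=> [c|v|{}f g _ tf _ tg|{}f g _ tf _ tg|F {}f dF _ tf].
- exact: tame_cst.
- exact: tL.
- exact: tameD.
- exact: tameM.
- exact: (tame_comp dF tf).
Qed.

Definition is_gradient k (f : car R k -> R) (p : car R k -> car R k) : Prop :=
  forall z v, is_derive (0 : R) (1 : R) (fun s => f (addv z (scalev s v))) (dotv (p z) v).

Lemma is_gradientM k (f g : car R k -> R) p q : is_gradient f p -> is_gradient g q ->
  is_gradient (fun z => f z * g z) (fun z => addv (scalev (f z) (q z)) (scalev (g z) (p z))).
Proof.
move=> fp gq z v; have df := fp z v; have dg := gq z v.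
apply: (is_derive_eq (is_deriveM df dg)).
by rewrite /= scale0v addv0 !dotvE.
Qed.

Lemma is_gradientZ k c (f : car R k -> R) p : is_gradient f p ->
  is_gradient (fun z => c * f z) (fun z => scalev c (p z)).
Proof.
move=> fp z v; have df := fp z v.
by apply: (is_derive_eq (is_deriveZ c df)); rewrite dotvZl.
Qed.

Lemma is_gradient_comp k (F F' : R -> R) (f : car R k -> R) p :
  (forall x, is_derive x (1 : R) F (F' x)) -> is_gradient f p ->
  is_gradient (fun z => F (f z)) (fun z => scalev (F' (f z)) (p z)).
Proof.
move=> dF fp z v; have df := fp z v.
have dFz : is_derive (f (addv z (scalev 0 v))) (1 : R) F (F' (f z)).
  by rewrite scale0v addv0; exact: dF.
by have := is_derive1_comp dFz df; rewrite dotvZl.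
Qed.

Lemma is_gradient_dotv k (u : car R k) : is_gradient (fun z => dotv z u) (fun=> u).
Proof.
move=> z v; rewrite (_ : (fun s => _) = fun s => dotv z u + s * dotv v u); last first.
  by apply/funext => s; rewrite !dotvE.
have dl := is_deriveD (is_derive_cst (dotv z u) (0 : R) (1 : R))
  (is_deriveM (is_derive_id (0 : R) (1 : R)) (is_derive_cst (dotv v u) (0 : R) (1 : R))).
apply: (is_derive_eq dl).
by rewrite /= add0r scale0r add0r dotvC -[RHS]mulr1.
Qed.

Lemma tame_gradient k (f : car R k -> R) : tame f ->
  exists2 p, (forall v, tame (fun z => dotv (p z) v)) & is_gradient f p.
Proof.
elim=> [c|v|{}f g _ [p tp fp] _ [q tq gq]|{}f g tf [p tp fp] tg [q tq gq]|F {}f dF tf [p tp fp]].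
- exists (fun=> zerov R k); first by move=> v; exact: tame_cst.
  by move=> z v; rewrite dotv0l; exact: is_derive_cst.
- exists (fun=> v); first by move=> u; exact: tame_cst.
  exact: is_gradient_dotv.
- exists (fun z => addv (p z) (q z)).
    by move=> v; under eq_fun do rewrite dotvDl; exact: tameD.
  by move=> z v; rewrite dotvDl; apply: is_deriveD; [exact: fp|exact: gq].
- exists (fun z => addv (scalev (f z) (q z)) (scalev (g z) (p z))).
    move=> v; under eq_fun do rewrite !dotvE.
    by apply: tameD; exact: tameM.
  exact: is_gradientM.
- exists (fun z => scalev (F 1%N (f z)) (p z)).
    move=> v; under eq_fun do rewrite !dotvE.
    by apply: tameM => //; apply: (tame_comp (F := fun n => F n.+1)) tf => n x; exact: dF.
  by apply: is_gradient_comp => //; exact: dF.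
Qed.

Lemma is_gradient_dirder k (f : car R k -> R) p : is_gradient f p ->
  forall z v, dirder f z v = dotv (p z) v.
Proof. by move=> fp z v; rewrite /dirder derive1E; have [] := fp z v. Qed.

Lemma tame_dirder k (f : car R k -> R) v : tame f -> tame (fun z => dirder f z v).
Proof.
move=> /tame_gradient[p tp fp].
by under eq_fun do rewrite (is_gradient_dirder fp).
Qed.

Lemma is_derive_dirder k (f : car R k -> R) z v : tame f ->
  is_derive (0 : R) (1 : R) (fun s => f (addv z (scalev s v))) (dirder f z v).
Proof. by move=> /tame_gradient[p _ fp]; rewrite (is_gradient_dirder fp). Qed.

Lemma dirderZ k (f : car R k -> R) z s v : tame f ->
  dirder f z (scalev s v) = s * dirder f z v.
Proof. by move=> /tame_gradient[p _ fp]; rewrite !(is_gradient_dirder fp) dotvZr. Qed.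

Lemma tame_econt k (f : car R k -> R) : tame f -> econt f.
Proof.
move=> tf; apply/econtP; elim: tf => [c|v|{}f g _ cf _ cg|{}f g _ cf _ cg|F {}f dF _ cf] z.
- exact: cvg_cst.
- apply/cvgrPdist_lt => e e0; have v1 : 0 < enorm v + 1 by rewrite ltr_wpDl// enorm_ge0.
  exists (e / (enorm v + 1)); first by rewrite /= divr_gt0.
  move=> w /=; rewrite ltr_pdivlMr// => we.
  rewrite distrC -dotvBl; apply: le_lt_trans we.
  by rewrite (le_trans (normr_dotv_le _ _))// ler_wpM2l ?enorm_ge0// lerDl.
- by apply: cvgD.
- by apply: cvgM.
- by apply: (cvg_comp f) (cf z) _; exact: (deriv_seq_continuous (n := 0%N) dF).
Qed.

Lemma tame_smooth k (f : car R k -> R) : tame f -> smooth f.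
Proof.
move=> tf vs.
have t : tame (iterD vs f) by elim: vs => [//|v vs IH] /=; exact: tame_dirder.
split; first exact: tame_econt.
by move=> z v; have [] := is_derive_dirder z v t.
Qed.

Lemma tame_bounded k (f : car R k -> R) (M : R) : tame f ->
  exists C, forall z, enorm z <= M -> `|f z| <= C.
Proof.
elim=> [c|v|{}f g _ [C fC] _ [D gD]|{}f g _ [C fC] _ [D gD]|F {}f dF _ [C fC]].
- by exists `|c|.
- exists (M * enorm v) => z zM.
  by rewrite (le_trans (normr_dotv_le _ _))// ler_wpM2r ?enorm_ge0.
- by exists (C + D) => z zM; rewrite (le_trans (ler_normD _ _))// lerD// ?fC ?gD.
- by exists (C * D) => z zM; rewrite normrM ler_pM// ?fC ?gD.
- have cF : {within `[- `|C|, `|C|], continuous (fun x => `|F 0%N x|)}.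
    apply: continuous_subspaceT => x; apply: continuous_comp; last exact: norm_continuous.
    exact: (deriv_seq_continuous dF).
  have [c _ F_le] := EVT_max (ge0_cp (normr_ge0 C)).2 cF.
  exists `|F 0%N c| => // z /fC fzC; apply: F_le.
  by rewrite in_itv/= -ler_norml (le_trans fzC)// ler_norm.
Qed.

Lemma measurable_dotv k (v : car R k) : measurable_fun setT (fun z : car R k => dotv z v).
Proof.
elim: k v => [|k IH] v.
  exact: (measurable_funM (@measurable_id _ (measurableTypeR R) setT) (measurable_cst _)).
apply: measurable_funD.
  by apply: measurable_funM; [exact: measurable_fst|exact: measurable_cst].
exact: (measurableT_comp (IH v.2) measurable_snd).
Qed.

Lemma tame_measurable k (D : set (car R k)) (f : car R k -> R) : tame f -> measurable_fun D f.
Proof.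
move=> tf; apply: measurable_funTS.
elim: tf => [c|v|{}f g _ mf _ mg|{}f g _ mf _ mg|F {}f dF _ mf].
- exact: measurable_cst.
- exact: measurable_dotv.
- exact: measurable_funD.
- exact: measurable_funM.
- apply: (measurableT_comp _ mf).
  by apply: continuous_measurable_fun; exact: (deriv_seq_continuous dF).
Qed.

Lemma measurable_fun_dotv d (T : measurableType d) k (f : T -> car R k) :
  (forall v, measurable_fun setT (fun t => dotv (f t) v)) -> measurable_fun setT f.
Proof.
elim: k f => [|k IH] f mf.
  have := mf (1 : R); congr measurable_fun; apply/funext => t.
  by rewrite /= mulr1.
apply/measurable_fun_pairP; split.
  have := mf ((1 : R), zerov R k); congr measurable_fun; apply/funext => t.
  by rewrite /= mulr1 dotv0r addr0.
apply: IH => v; have := mf ((0 : R), v); congr measurable_fun; apply/funext => t.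
by rewrite /= mulr0 add0r.
Qed.

End tame_functions.

(** * The flat exponential *)

Section flat_exponential.
Context {R : realType}.
Implicit Types (P : {poly R}) (x : R).

Definition flat_exp P x : R := if 0 < x then P.[x^-1] * expR (- x^-1) else 0.

(* [d/dx (P(1/x) exp(-1/x)) = x^-2 (P(1/x) - P'(1/x)) exp(-1/x)]. *)
Definition flat_deriv P : {poly R} := 'X^2 * (P - P^`()).

Lemma flat_exp_le0 P x : x <= 0 -> flat_exp P x = 0.
Proof. by rewrite /flat_exp leNgt => /negbTE ->. Qed.

Lemma horner_le_expn P : exists2 C : R, 0 <= C &
  forall y, 1 <= y -> `|P.[y]| <= C * y ^+ size P.
Proof.
exists (\sum_(i < size P) `|P`_i|); first exact: sumr_ge0.
move=> y y1; rewrite horner_coef mulr_suml.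
apply: le_trans (ler_norm_sum _ _ _) _; apply: ler_sum => i _.
rewrite normrM ler_wpM2l// normrX ger0_norm ?(le_trans _ y1)//.
by rewrite ler_weXn2l// ltnW.
Qed.

Lemma flat_exp_quadratic P : exists2 C : R, 0 <= C &
  forall x, x <= 1 -> `|flat_exp P x| <= C * x ^+ 2.
Proof.
have [C C0 PC] := horner_le_expn P; pose n := size P.
exists (C * n.+2`!%:R); first by rewrite mulr_ge0// ler0n.
move=> x x1; have [x0|x0] := leP x 0.
  by rewrite flat_exp_le0// normr0 mulr_ge0 ?sqr_ge0// mulr_ge0// ler0n.
rewrite /flat_exp x0; pose y := x^-1.
have y1 : 1 <= y by rewrite /y invf_ge1.
have y0 : 0 < y by rewrite (lt_le_trans _ y1).
have -> : x = y^-1 by rewrite /y invrK.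
rewrite invrK expRN normrM [X in _ * X]ger0_norm ?invr_ge0 ?expR_ge0//.
have exp_ge : y ^+ n.+2 / n.+2`!%:R <= expR y.
  by apply: le_trans (expR_ge1Dxn n.+1 (ltW y0)); rewrite lerDr.
rewrite ler_pdivrMr ?expR_gt0//.
apply: le_trans (PC _ y1) _; rewrite -mulrA -mulrA ler_wpM2l//.
rewrite ler_pdivrMr ?ltr0n ?fact_gt0// in exp_ge.
by rewrite mulrAC [y^-1 ^+ 2]exprVn ler_pdivlMr ?exprn_gt0// -exprD addn2 mulrC.
Qed.

Lemma is_derive_quadratic (f : R -> R) (C : R) : f 0 = 0 ->
  (forall x, x <= 1 -> `|f x| <= C * x ^+ 2) -> is_derive (0 : R) (1 : R) f 0.
Proof.
move=> f0 fC.
suff quotient0 : h^-1 *: (f (h *: 1 + 0) - f 0) @[h --> (0 : R)^'] --> (0 : R).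
  apply: DeriveDef; first by apply/cvg_ex; exists 0.
  exact: cvg_lim quotient0.
apply/cvgrPdist_le => /= e e0; near=> h.
rewrite sub0r normrN f0 subr0 addr0 /GRing.scale/= mulr1 normrM normfV.
have h_neq0 : h != 0 by near: h; exact: nbhs_dnbhs_neq.
rewrite mulrC ler_pdivrMr ?normr_gt0//.
have h1 : `|h| <= 1 by near: h; apply: dnbhs0_le.
apply: le_trans (fC _ (le_trans (ler_norm _) h1)) _.
rewrite -real_normK ?num_real// expr2 mulrA ler_wpM2r//.
apply: le_trans (_ : (`|C| + 1) * `|h| <= _).
  by rewrite ler_wpM2r// ler_wpDr// ler_norm.
rewrite mulrC -ler_pdivlMr ?ltr_wpDl//.
by near: h; apply: dnbhs0_le; rewrite divr_gt0// ltr_wpDl.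
Unshelve. all: by end_near. Qed.

Lemma is_derive_flat_exp P x :
  is_derive x (1 : R) (flat_exp P) (flat_exp (flat_deriv P) x).
Proof.
have [x0|x0|->] := ltgtP x 0.
- rewrite [X in is_derive _ _ _ X]flat_exp_le0 ?ltW//.
  apply: (near_eq_is_derive _ (is_derive_cst (0 : R) x (1 : R))).
  near=> y; rewrite flat_exp_le0//; apply: ltW.
  by near: y; exact: lt_nbhsl.
- rewrite /flat_exp x0.
  have x_neq0 : x != 0 by rewrite gt_eqF.
  have dV := @is_deriveV R id x 1 1 x_neq0 (is_derive_id x 1).
  have dP := is_derive1_comp (is_derive_poly P (x^-1)) dV.
  have dE := @is_derive1_comp R expR (fun y => - y^-1) x _ _
    (is_derive_expR (- x^-1)) (is_deriveN dV).
  apply: (near_eq_is_derive _ (is_derive_eq (is_deriveM dP dE) _)).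
    by near=> y; rewrite ifT//; near: y; exact: lt_nbhsr.
  rewrite /= /flat_deriv /GRing.scale/= !hornerE exprVn /=.
  ring.
- rewrite [X in is_derive _ _ _ X]flat_exp_le0//.
  have [C _ PC] := flat_exp_quadratic P.
  by apply: is_derive_quadratic PC; rewrite flat_exp_le0.
Unshelve. all: by end_near. Qed.

Definition expNV : R -> R := flat_exp 1.

Definition dexpNV : R -> R := flat_exp (flat_deriv 1).

Lemma is_derive_expNV x : is_derive x (1 : R) expNV (dexpNV x).
Proof. exact: is_derive_flat_exp. Qed.

Lemma tame_expNV k (f : car R k -> R) : tame f -> tame (fun z => expNV (f z)).
Proof.
apply: (tame_comp (F := fun n => flat_exp (iter n flat_deriv 1))) => n x.
exact: is_derive_flat_exp.
Qed.

Lemma expNV_gt0E x : 0 < x -> expNV x = expR (- x^-1).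
Proof. by move=> x0; rewrite /expNV/flat_exp x0 hornerC mul1r. Qed.

Lemma expNV_eq0 x : x <= 0 -> expNV x = 0.
Proof. exact: flat_exp_le0. Qed.

Lemma expNV_ge0 x : 0 <= expNV x.
Proof.
have [/expNV_eq0->//|x0] := leP x 0.
by rewrite expNV_gt0E// expR_ge0.
Qed.

Lemma expNV_le1 x : expNV x <= 1.
Proof.
have [/expNV_eq0->//|x0] := leP x 0.
by rewrite expNV_gt0E// -expR0 ler_expR oppr_le0 invr_ge0 ltW.
Qed.

Lemma expNV_ge x y : 0 < x -> x <= y -> expR (- x^-1) <= expNV y.
Proof.
move=> x0 xy; have y0 := lt_le_trans x0 xy.
by rewrite expNV_gt0E// ler_expR lerN2 lef_pV2.
Qed.

Lemma expNV_cvg1 x : 0 < x -> expNV (n.+1%:R * x - 1) @[n --> \oo] --> (1 : R).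
Proof.
move=> x0; apply/cvgrPdist_le => e e0; near=> n.
have large : e^-1 <= n.+1%:R * x - 1.
  rewrite lerBrDr -ler_pdivrMr// -natr1 ler_wpDr//.
  by near: n; exact: nbhs_infty_ger.
have e_inv : 0 < e^-1 by rewrite invr_gt0.
rewrite ger0_norm ?subr_ge0 ?expNV_le1// lerBlDr -lerBlDl.
apply: le_trans (expNV_ge e_inv large); rewrite invrK.
exact: expR_ge1Dx.
Unshelve. all: by end_near. Qed.

Lemma dexpNV_eq0 x : x <= 0 -> dexpNV x = 0.
Proof. exact: flat_exp_le0. Qed.

Lemma dexpNV_bounded : exists2 C : R, 0 < C & forall x, x <= 1 -> `|dexpNV x| <= C.
Proof.
have [C C0 dC] := flat_exp_quadratic (flat_deriv 1).
exists (C + 1); first by rewrite ltr_wpDl.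
move=> x x1; have [x0|x0] := leP x 0.
  by rewrite dexpNV_eq0// normr0 ler_wpDr.
apply: le_trans (dC _ x1) _; rewrite ler_wpDr// ler_piMr//.
by rewrite expr_le1// ltW.
Qed.

End flat_exponential.

Section sqdist.
Context {R : realType}.
Implicit Types k : nat.

Definition sqdist k (x0 x : car R k) : R := dotv (subv x x0) (subv x x0).

Lemma sqdist_ge0 k (x0 x : car R k) : 0 <= sqdist x0 x.
Proof. exact: dotv_ge0. Qed.

Lemma tame_dotvB k (x0 v : car R k) : tame (fun x : car R k => dotv (subv x x0) v).
Proof.
under eq_fun do rewrite dotvBl.
by apply: tameB; [exact: tame_dotv|exact: tame_cst].
Qed.

Lemma tame_sqdist k (x0 : car R k) : tame (sqdist x0).
Proof.
rewrite (_ : sqdist x0 = fun x : car R k => \sum_(i < k.+1)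
  dotv (subv x x0) (basisv k i) * dotv (subv x x0) (basisv k i)).
  by apply: tame_sum => i; apply: tameM; exact: tame_dotvB.
by apply/funext => x; rewrite sum_dotv_basisv.
Qed.

Lemma is_gradient_sqdist k (x0 : car R k) :
  is_gradient (sqdist x0) (fun x => scalev 2 (subv x x0)).
Proof.
move=> z v; rewrite (_ : (fun s => _) = horner ((dotv v v)%:P * 'X * 'X +
   (2 * dotv (subv z x0) v)%:P * 'X + (sqdist x0 z)%:P)); last first.
  apply/funext => s; rewrite !hornerE /sqdist !dotvE (dotvC v z) (dotvC x0 z) (dotvC v x0).
  rewrite /=; ring.
apply: (is_derive_eq (is_derive_poly _ _)).
rewrite !(derivD, derivM, derivX, derivC) !hornerE /= !dotvE; ring.
Qed.

End sqdist.

(** * Compact supports *)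

Section balls_and_dilations.
Context {R : realType}.
Implicit Types k : nat.

Definition eball k (x0 : car R k) (r : R) : set (car R k) := [set x | enorm (subv x x0) < r].

Lemma eballE k (x0 : car R k) (r : R) : 0 < r -> eball x0 r = [set x | sqdist x0 x < r ^+ 2].
Proof. by move=> r0; apply/seteqP; split => x /=; rewrite /eball/= enorm_lt. Qed.

Lemma eball0E (t0 s : R) : eball (t0 : car R 0) s = `](t0 - s), (t0 + s)[%classic.
Proof.
apply/seteqP; split => t; rewrite /eball/= enorm0E /subv/= mulN1r in_itv/= ltr_norml;
  by move=> /andP[? ?]; apply/andP; split; lra.
Qed.

Lemma pcylE k (alpha r t0 : R) (x0 : car R k) : pcyl alpha r t0 x0 =
  eball (t0 : car R 0) (alpha * r ^+ 2) `*` eball x0 r.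
Proof. by apply/seteqP; split => -[t x]; rewrite eball0E. Qed.

Lemma ebounded_eball k (x0 : car R k) (r : R) : ebounded (eball x0 r).
Proof.
exists (r + enorm x0) => x xB.
rewrite (_ : x = addv (subv x x0) x0); last first.
  by apply: dotv_ext => v; rewrite !dotvE subrK.
by rewrite (le_trans (ler_enormD _ _))// lerD2r ltW.
Qed.

Lemma ebounded_setX k (A : set (car R 0)) (B : set (car R k)) :
  ebounded A -> ebounded B -> ebounded (A `*` B : set (car R k.+1)).
Proof.
move=> [M AM] [N BN]; exists (M + N) => z [zA zB].
by rewrite (le_trans (enorm_pair_le _))// lerD ?BN// -enorm0E AM.
Qed.

Lemma ebounded_pcyl k (alpha r t0 : R) (x0 : car R k) : ebounded (pcyl alpha r t0 x0).
Proof. by rewrite pcylE; apply: ebounded_setX; exact: ebounded_eball. Qed.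

Definition xvec k (v : car R k) : car R k.+1 := ((0 : R), v).

Definition dil k (w : car R k) (s : R) (x : car R k) : car R k := addv w (scalev s (subv x w)).

Definition xdil k (w : car R k) (s : R) (z : car R k.+1) : car R k.+1 := ((z.1 : R), dil w s z.2).

Lemma dilE k (w x v : car R k) s : dotv (dil w s x) v = s * dotv x v + (1 - s) * dotv w v.
Proof. by rewrite /dil !dotvE; ring. Qed.

Lemma dil1 k (w x : car R k) : dil w 1 x = x.
Proof. by apply: dotv_ext => v; rewrite dilE; ring. Qed.

Lemma dil_dil k (w x : car R k) s u : dil w s (dil w u x) = dil w (s * u) x.
Proof. by apply: dotv_ext => v; rewrite !dilE; ring. Qed.

Lemma dil_half_sym k (w x : car R k) : dil x 2^-1 w = dil w 2^-1 x.
Proof. by apply: dotv_ext => v; rewrite !dilE; field. Qed.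

Lemma subv_dil k (w x : car R k) s : subv (dil w s x) w = scalev s (subv x w).
Proof. by apply: dotv_ext => v; rewrite !dotvE; ring. Qed.

Lemma xdil1 k (w : car R k) z : xdil w 1 z = z.
Proof. by case: z => t x; rewrite /xdil/= dil1. Qed.

Lemma xdilK k (w : car R k) s : s != 0 -> cancel (xdil w s) (xdil w s^-1).
Proof. by move=> s0 [t x]; rewrite /xdil/= dil_dil mulVf// dil1. Qed.

Lemma xdil_line k (w : car R k) (s : R) (z : car R k.+1) (v : car R k) (u : R) :
  xdil w s (addv z (scalev u (xvec v))) = addv (xdil w s z) (scalev u (xvec (scalev s v))).
Proof.
case: z => t x; rewrite /xdil/=; congr pair.
by apply: dotv_ext => y; rewrite !dotvE; ring.
Qed.

Lemma xdil_shift k (w : car R k) (s u : R) (z : car R k.+1) :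
  xdil w (s + u) z = addv (xdil w s z) (scalev u (xvec (subv z.2 w))).
Proof.
case: z => t x; rewrite /xdil/=; congr pair; first by rewrite mulr0 addr0.
by apply: dotv_ext => y; rewrite !dotvE; ring.
Qed.

Lemma enorm_xdil_le k (w : car R k) s z :
  enorm (xdil w s z) <= enorm z + (enorm w + `|s| * (enorm z + enorm w)).
Proof.
apply: le_trans (enorm_pair_le _) _; apply: lerD; first exact: (ler_enorm_fst z).
apply: le_trans (ler_enormD _ _) _; rewrite lerD2l enormZ ler_wpM2l//.
by apply: le_trans (ler_enormB _ _) _; rewrite lerD2r ler_enorm_snd.
Qed.

Lemma eball_dil k (x0 w x : car R k) (r s : R) : 1 <= s ->
  eball x0 r w -> eball x0 r (dil w s x) -> eball x0 r x.
Proof.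
rewrite /eball/= => s1 wB xB; have s0 : 0 < s by rewrite (lt_le_trans _ s1).
have sV0 : 0 < s^-1 by rewrite invr_gt0.
have sV1 : 0 <= 1 - s^-1 by rewrite subr_ge0 invf_le1.
have -> : subv x x0 = addv (scalev (1 - s^-1) (subv w x0)) (scalev s^-1 (subv (dil w s x) x0)).
  by apply: dotv_ext => v; rewrite !dotvE; field; rewrite gt_eqF.
apply: le_lt_trans (ler_enormD _ _) _.
rewrite !enormZ (ger0_norm sV1) (gtr0_norm sV0) -[ltRHS](subrK (s^-1 * r)) ler_ltD ?ltr_pM2l//.
rewrite (_ : r - s^-1 * r = (1 - s^-1) * r); last by ring.
by rewrite ler_wpM2l// ltW.
Qed.

Lemma tame_fst k (f : car R 0 -> R) : tame f -> tame (fun z : car R k.+1 => f z.1).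
Proof.
apply: tame_precomp => v.
have := @tame_dotv R k.+1 ((v : R), zerov R k); congr tame; apply/funext => z /=.
by rewrite dotv0r addr0.
Qed.

Lemma tame_snd k (f : car R k -> R) : tame f -> tame (fun z : car R k.+1 => f z.2).
Proof.
apply: tame_precomp => v.
have := @tame_dotv R k.+1 ((0 : R), v); congr tame; apply/funext => z /=.
by rewrite mulr0 add0r.
Qed.

Lemma tame_dotv_dil k (w v : car R k) s : tame (fun x => dotv (dil w s x) v).
Proof.
under eq_fun do rewrite dilE; apply: tameD; last exact: tame_cst.
by apply: tameZ; exact: tame_dotv.
Qed.

Lemma tame_dotv_xdil k (w : car R k) s v : tame (fun z => dotv (xdil w s z) v).
Proof.
apply: (tameD (f := fun z : car R k.+1 => (z.1 : R) * v.1)).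
  exact: (tame_fst k (@tame_dotv R 0 (v.1 : R))).
exact: (tame_snd (tame_dotv_dil w v.2 s)).
Qed.

Lemma tame_xdil k (w : car R k) s (f : car R k.+1 -> R) :
  tame f -> tame (fun z => f (xdil w s z)).
Proof. by apply: tame_precomp => v; exact: tame_dotv_xdil. Qed.

Lemma measurable_xdil k (w : car R k) s : measurable_fun setT (xdil w s).
Proof.
by apply: (@measurable_fun_dotv _ _ _ k.+1) => v; apply: tame_measurable; exact: tame_dotv_xdil.
Qed.

Lemma measurable_dil k (w : car R k) s : measurable_fun setT (dil w s).
Proof.
by apply: measurable_fun_dotv => v; apply: tame_measurable; exact: tame_dotv_dil.
Qed.

End balls_and_dilations.

Section compact_support.
Context {R : realType}.
Implicit Types k : nat.

Lemma eclosed_le k (f : car R k -> R) (c : R) : econt f -> eclosed [set z | f z <= c].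
Proof.
move=> cf z adh_z /=; rewrite leNgt; apply/negP => cfz.
have [d d0 fd] := cf z (f z - c) ltac:(by rewrite subr_gt0).
have [w /= fwc wz] := adh_z d d0.
by have := fd _ wz; rewrite ltr_norml => /andP[]; lra.
Qed.

Lemma eclosed_setX k (A : set (car R 0)) (B : set (car R k)) :
  eclosed A -> eclosed B -> eclosed (A `*` B : set (car R k.+1)).
Proof.
move=> cA cB z adh_z; split; [apply: cA => e e0|apply: cB => e e0].
  have [w [Aw _] wz] := adh_z e e0; exists (w.1 : R) => //.
  by rewrite enorm0E (le_lt_trans (ler_enorm_fst _) wz).
have [w [_ Bw] wz] := adh_z e e0; exists w.2 => //.
exact: (le_lt_trans (ler_enorm_snd _) wz).
Qed.

Lemma eclosed_setU k (A B : set (car R k)) : eclosed A -> eclosed B -> eclosed (A `|` B).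
Proof.
move=> cA cB z adh_z; apply: contrapT => /not_orP[nA nB].
have away (C : set (car R k)) : eclosed C -> ~ C z ->
    exists2 e : R, 0 < e & forall w, C w -> e <= enorm (subv w z).
  move=> cC; apply: contra_notP => /forall2NP near_z; apply: cC => e e0.
  have [//|/existsNP[w /not_implyP[Cw /negP]]] := near_z e.
  by rewrite -ltNge; exists w.
have [d d0 Ad] := away _ cA nA; have [e e0 Be] := away _ cB nB.
have [|w ABw] := adh_z (Num.min d e); first by rewrite lt_min d0.
by rewrite lt_min => /andP[]; case: ABw => [/Ad|/Be]; rewrite leNgt => /negP.
Qed.

Lemma eclosed_xdil k (w : car R k) s K : eclosed K -> eclosed (xdil w s @^-1` K).
Proof.
move=> cK z adh_z; apply: cK => e e0.
have M0 : 0 < 1 + `|s| by rewrite ltr_pwDl.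
have [y Ky yz] := adh_z (e / (1 + `|s|)) (divr_gt0 e0 M0); exists (xdil w s y) => //.
have -> : subv (xdil w s y) (xdil w s z) =
    ((subv y z).1 : R, scalev s (subv y z).2) :> car R k.+1.
  rewrite /subv /xdil/=; congr pair.
  by apply: dotv_ext => v; rewrite !dotvE; ring.
apply: le_lt_trans (enorm_pair_le _) _; rewrite /= enormZ.
apply: le_lt_trans (_ : (1 + `|s|) * enorm (subv y z) < _); last by rewrite mulrC -ltr_pdivlMr.
rewrite mulrDl mul1r; apply: lerD; first exact: (ler_enorm_fst (subv y z)).
by rewrite ler_wpM2l//; exact: (ler_enorm_snd (subv y z)).
Qed.

Lemma compact_support_out k D (f : car R k -> R) z :
  compact_support_in D f -> ~ D z -> f z = 0.
Proof. by move=> [K [_ _ KD f0]] nDz; apply: f0 => /KD. Qed.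

Lemma compact_supportM k D (u f : car R k -> R) :
  compact_support_in D f -> compact_support_in D (fun z => u z * f z).
Proof. by move=> [K [? ? ? f0]]; exists K; split => // z /f0 ->; rewrite mulr0. Qed.

Lemma compact_supportD k D (f g : car R k -> R) :
  compact_support_in D f -> compact_support_in D g -> compact_support_in D (fun z => f z + g z).
Proof.
move=> [K [cK [M KM] KD f0]] [L [cL [N LN] LD g0]]; exists (K `|` L); split.
- exact: eclosed_setU.
- exists (Num.max M N) => z [/KM|/LN] zMN; first by rewrite (le_trans zMN)// le_max lexx.
  by rewrite (le_trans zMN)// le_max lexx orbT.
- by move=> z [/KD|/LD].
- by move=> z /not_orP[/f0 -> /g0 ->]; rewrite addr0.
Qed.

Lemma compact_support_setX k (A : set (car R 0)) (B : set (car R k)) f g :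
  compact_support_in A f -> compact_support_in B g ->
  compact_support_in (A `*` B : set (car R k.+1)) (fun z => f (z.1 : R) * g z.2).
Proof.
move=> [K [cK bK KA f0]] [L [cL bL LB g0]]; exists (K `*` L); split.
- exact: eclosed_setX.
- exact: ebounded_setX.
- by move=> z [/KA ? /LB].
- by move=> z /not_andP[/f0 ->|/g0 ->]; rewrite (mul0r, mulr0).
Qed.

Lemma compact_support_xdil k D (f : car R k.+1 -> R) (w : car R k) s :
  ebounded D -> (forall z, D (xdil w s z) -> D z) ->
  compact_support_in D f -> compact_support_in D (fun z => f (xdil w s z)).
Proof.
move=> [M DM] Dstar [K [cK _ KD f0]]; exists (xdil w s @^-1` K); split.
- exact: eclosed_xdil.
- by exists M => z /KD/Dstar/DM.
- by move=> z /KD/Dstar.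
- by move=> z /f0.
Qed.

Lemma compact_support_eball k (x0 : car R k) (r m : R) f : 0 < r -> m < r ^+ 2 ->
  (forall x, m < sqdist x0 x -> f x = 0) -> compact_support_in (eball x0 r) f.
Proof.
move=> r0 mr f0; have sub : [set x | sqdist x0 x <= m] `<=` eball x0 r.
  by move=> x /= xm; rewrite eballE//=; exact: le_lt_trans mr.
exists [set x | sqdist x0 x <= m]; split => //.
- exact/eclosed_le/tame_econt/tame_sqdist.
- by have [M BM] := ebounded_eball x0 r; exists M => x /sub/BM.
- by move=> x /negP; rewrite -ltNge => /f0.
Qed.

Lemma eclosed_closed (K : set (car R 0)) : eclosed K -> closed (K : set R).
Proof.
move=> cK z adh_z; apply: cK => e e0.
have [w [Kw zw]] := adh_z _ (nbhsx_ballx (z : R) e e0).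
by exists w => //; rewrite enorm0E /subv/= mulN1r distrC.
Qed.

Lemma sqdist0E (t0 t : R) : sqdist (t0 : car R 0) (t : car R 0) = (t - t0) ^+ 2.
Proof. by rewrite /sqdist/subv/= mulN1r expr2. Qed.

Lemma compact_support_eball0 (t0 s : R) (f : car R 0 -> R) : 0 < s ->
  compact_support_in (eball (t0 : car R 0) s) f ->
  exists2 m : R, m < s ^+ 2 & forall t : R, m < (t - t0) ^+ 2 -> f t = 0.
Proof.
move=> s0 [K [cK [M KM] KD f0]].
have [K0|/set0P K_neq0] := eqVneq K set0.
  by exists 0; rewrite ?exprn_gt0// => t _; apply: f0; rewrite K0.
have compactK : compact (K : set R).
  apply: subclosed_compact (eclosed_closed cK) (@segment_compact _ (- M) M) _ => t /KM.
  by rewrite enorm0E ler_norml /= in_itv.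
have [|c cK' c_max] := @compact_EVT_max _ R (fun t : R => (t - t0) ^+ 2) _ K_neq0 compactK.
  apply: continuous_subspaceT => t.
  apply: (@continuous_comp _ _ _ (fun t => t - t0) (fun u => u ^+ 2)).
    by apply: cvgB; [exact: cvg_id|exact: cvg_cst].
  exact: exprn_continuous.
exists ((c - t0) ^+ 2).
  by move: cK'; rewrite inE => /KD; rewrite eballE//= sqdist0E.
move=> t ct; apply: f0 => /mem_set /c_max; by rewrite leNgt ct.
Qed.

End compact_support.

Section cutoffs.
Context {R : realType}.
Implicit Types k : nat.

Definition has_cutoffs k (D : set (car R k)) : Prop := exists b : nat -> car R k -> R,
  [/\ forall n, tame (b n), forall n, compact_support_in D (b n),
      forall n z, 0 <= b n z <= 1 & forall z, D z -> b n z @[n --> \oo] --> (1 : R)].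

Lemma has_cutoffs_eball k (x0 : car R k) (r : R) : 0 < r -> has_cutoffs (eball x0 r).
Proof.
move=> r0; exists (fun n x => expNV (n.+1%:R * (r ^+ 2 - sqdist x0 x) - 1)); split.
- move=> n; apply: tame_expNV; apply: tameB; last exact: tame_cst.
  by apply: tameZ; apply: tameB; [exact: tame_cst|exact: tame_sqdist].
- move=> n; apply: (compact_support_eball (m := r ^+ 2 - n.+1%:R^-1)) => //.
    by rewrite ltrBlDr ltrDl invr_gt0.
  move=> x; rewrite ltrBlDr addrC -ltrBlDr => xm; apply: expNV_eq0.
  by rewrite subr_le0 -ler_pdivlMl// mulr1 ltW.
- by move=> n x; rewrite expNV_ge0 expNV_le1.
- by move=> x; rewrite eballE//= => xr; apply: expNV_cvg1; rewrite subr_gt0.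
Qed.

Lemma has_cutoffs_setX k (A : set (car R 0)) (B : set (car R k)) :
  has_cutoffs A -> has_cutoffs B -> has_cutoffs (A `*` B : set (car R k.+1)).
Proof.
move=> [b [tb sb b01 cb]] [c [tc sc c01 cc]].
exists (fun n z => b n (z.1 : R) * c n z.2); split => [n|n|n z|z [zA zB]].
- by apply: tameM; [exact: tame_fst|exact: tame_snd].
- exact: compact_support_setX.
- have /andP[b0 b1] := b01 n (z.1 : R); have /andP[c0 c1] := c01 n z.2.
  by rewrite mulr_ge0//= mulr_ile1.
- by rewrite -[X in _ --> X]mulr1; apply: cvgM; [exact: cb|exact: cc].
Qed.

Lemma has_cutoffs_pcyl k (alpha r t0 : R) (x0 : car R k) : 0 < alpha -> 0 < r ->
  has_cutoffs (pcyl alpha r t0 x0).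
Proof.
move=> alpha0 r0; rewrite pcylE; apply: has_cutoffs_setX; apply: has_cutoffs_eball => //.
by rewrite mulr_gt0// exprn_gt0.
Qed.

End cutoffs.

(** * Lebesgue measure *)

Section tonelli_on_rectangles.
Context d1 d2 (T1 : measurableType d1) (T2 : measurableType d2) (R : realType).
Variables (m1 : {sigma_finite_measure set T1 -> \bar R}).
Variables (m2 : {sigma_finite_measure set T2 -> \bar R}).
Variables (A : set T1) (B : set T2) (f : T1 * T2 -> \bar R).
Hypotheses (mA : measurable A) (mB : measurable B).
Hypotheses (mf : measurable_fun setT f) (f0 : forall z, (0 <= f z)%E).
Local Open Scope ereal_scope.

Let f_AB_ge0 z : 0 <= (f \_ (A `*` B)) z. Proof. exact: erestrict_ge0. Qed.

Let mf_AB : measurable_fun setT (f \_ (A `*` B)).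
Proof.
apply/(measurable_restrictT _ (measurableX mA mB)); exact: measurable_funTS.
Qed.

Lemma integral_xsection_setX x :
  \int[m2]_y (f \_ (A `*` B)) (x, y) = ((fun x => \int[m2]_(y in B) f (x, y)) \_ A) x.
Proof.
rewrite patchE; case: ifPn => xA.
  rewrite [RHS]integral_mkcond; apply: eq_integral => y _.
  by rewrite !patchE in_setX /= xA.
by rewrite integral0_eq// => y _; rewrite patchE in_setX/= (negbTE xA).
Qed.

Lemma integral_ysection_setX y :
  \int[m1]_x (f \_ (A `*` B)) (x, y) = ((fun y => \int[m1]_(x in A) f (x, y)) \_ B) y.
Proof.
rewrite patchE; case: ifPn => yB.
  rewrite [RHS]integral_mkcond; apply: eq_integral => x _.
  by rewrite !patchE in_setX /= yB andbT.
by rewrite integral0_eq// => x _; rewrite patchE in_setX/= (negbTE yB) andbF.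
Qed.

Lemma tonelli_setX :
  \int[m1]_(x in A) \int[m2]_(y in B) f (x, y) = \int[m2]_(y in B) \int[m1]_(x in A) f (x, y).
Proof.
rewrite integral_mkcond [RHS]integral_mkcond.
under eq_integral do rewrite -integral_xsection_setX.
under [RHS]eq_integral do rewrite -integral_ysection_setX.
exact: fubini_tonelli.
Qed.

Lemma tonelli1_setX :
  \int[m1 \x m2]_(z in A `*` B) f z = \int[m1]_(x in A) \int[m2]_(y in B) f (x, y).
Proof.
rewrite integral_mkcond [RHS]integral_mkcond fubini_tonelli1//.
by apply: eq_integral => x _; exact: integral_xsection_setX.
Qed.

End tonelli_on_rectangles.

Lemma measurable_integral_xsection d1 d2 (T1 : measurableType d1) (T2 : measurableType d2)
    (R : realType) (m2 : {sigma_finite_measure set T2 -> \bar R}) (D : set T1) (B : set T2)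
    (f : T1 * T2 -> \bar R) :
  measurable B -> measurable_fun setT f -> (forall z, (0 <= f z)%E) ->
  measurable_fun D (fun x => \int[m2]_(y in B) f (x, y))%E.
Proof.
move=> mB mf f0; apply: measurable_funTS.
rewrite (_ : (fun x => _) = fun x => (\int[m2]_y (f \_ (setT `*` B)) (x, y))%E); last first.
  apply/funext => x; rewrite [RHS](_ : _ = (\int[m2]_y ((fun y => f (x, y)) \_ B) y)%E).
    by rewrite integral_mkcond.
  by apply: eq_integral => y _; rewrite !patchE in_setX in_setT.
apply: measurable_fun_fubini_tonelli_F; last by move=> z; exact: erestrict_ge0.
apply/(measurable_restrictT _ (measurableX measurableT mB)); exact: measurable_funTS.
Qed.

Section lebesgue_product.
Context {R : realType}.
Implicit Types k : nat.
Local Open Scope ereal_scope.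

Lemma leb_setX k (A : set (car R 0)) (B : set (car R k)) :
  measurable A -> measurable B -> leb R k.+1 (A `*` B) = leb R 0 A * leb R k B.
Proof. by move=> mA mB; exact: product_measure2E. Qed.

Lemma measurable_eball k (x0 : car R k) (r : R) : (0 < r)%R -> measurable (eball x0 r).
Proof.
move=> r0; rewrite eballE//.
have := tame_measurable (tame_sqdist x0) measurableT (measurable_itv `]-oo, (r ^+ 2)%R[).
by rewrite setTI; congr measurable; apply/seteqP; split => x /=; rewrite in_itv.
Qed.

Lemma leb_eball0 (t0 s : R) : (0 < s)%R -> leb R 0 (eball (t0 : car R 0) s) = (2 * s)%:E.
Proof.
move=> s0; rewrite eball0E /= lebesgue_measure_itv/= lte_fin ifT; last by lra.
by rewrite -EFinB; congr EFin; ring.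
Qed.

Lemma leb_eball_lty k (x0 : car R k) (r : R) : (0 < r)%R -> leb R k (eball x0 r) < +oo.
Proof.
move=> r0; elim: k x0 => [|k IH] x0; first by rewrite leb_eball0 ?ltry.
have mBr j (y : car R j) : measurable (eball y r) by exact: measurable_eball.
apply: le_lt_trans (_ : leb R k.+1 (eball (x0.1 : car R 0) r `*` eball x0.2 r) < _).
  apply: le_measure; rewrite ?inE//; first exact: (measurableX (mBr 0%N _) (mBr k _)).
  move=> x xB; split; last exact: (le_lt_trans (ler_enorm_snd _) xB).
  by rewrite /eball/= enorm0E; exact: (le_lt_trans (ler_enorm_fst _) xB).
by rewrite leb_setX// leb_eball0// lte_mul_pinfty// lee_fin mulr_ge0// ltW.
Qed.

Lemma leb_eball_gt0 k (x0 : car R k) (r : R) : (0 < r)%R -> 0 < leb R k (eball x0 r).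
Proof.
elim: k x0 r => [|k IH] x0 r r0; first by rewrite leb_eball0 ?lte_fin ?mulr_gt0.
have r_half0 : (0 < r / 2)%R by rewrite divr_gt0.
have mBr j (y : car R j) : measurable (eball y (r / 2)) by exact: measurable_eball.
apply: lt_le_trans (_ : leb R k.+1 (eball (x0.1 : car R 0) (r / 2) `*` eball x0.2 (r / 2)) <= _).
  by rewrite leb_setX// mule_gt0// ?IH// leb_eball0// lte_fin mulr_gt0.
apply: le_measure; rewrite ?inE//; last 2 first.
- exact: measurable_eball.
- move=> x []; rewrite /eball/= enorm0E => x1 x2.
  by rewrite (le_lt_trans (enorm_pair_le _))// [ltRHS]splitr ltrD.
exact: (measurableX (mBr 0%N _) (mBr k _)).
Qed.

Lemma fine_leb_eball k (x0 : car R k) (r : R) : (0 < r)%R ->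
  (fine (leb R k (eball x0 r)))%:E = leb R k (eball x0 r).
Proof. by move=> r0; rewrite fineK// ge0_fin_numE// leb_eball_lty. Qed.

Lemma fine_leb_eball_gt0 k (x0 : car R k) (r : R) : (0 < r)%R ->
  (0 < fine (leb R k (eball x0 r)))%R.
Proof. by move=> r0; rewrite fine_gt0// leb_eball_gt0// leb_eball_lty. Qed.

Lemma leb_sigma_finite k : sigma_finite setT (leb R k).
Proof.
exists (fun n => eball (zerov R k) n.+1%:R); last first.
  by move=> n; split; [exact: measurable_eball|exact: leb_eball_lty].
apply/seteqP; split => // x _; exists (Num.truncn (enorm (subv x (zerov R k)))) => //.
exact: truncnS_gt.
Qed.

(* [leb R k] is a bundled measure: its sigma-finiteness is recorded on this copy. *)
Definition sfleb k : set (car R k) -> \bar R := leb R k.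
HB.instance Definition _ k := Measure.copy (@sfleb k) (leb R k).
HB.instance Definition _ k :=
  Measure_isSigmaFinite.Build _ _ _ (@sfleb k) (leb_sigma_finite k).

Lemma product_sflebE k (A : set (car R k.+1)) : measurable A ->
  (@sfleb 0 \x @sfleb k) A = leb R k.+1 A.
Proof.
move=> mA.
apply: (@product_measure_unique _ _ _ _ R (@sfleb 0) (@sfleb k) (leb R k.+1)) => // B C mB mC.
exact: product_measure2E.
Qed.

Lemma integral_product_sflebE k (D : set (car R k.+1)) (f : car R k.+1 -> \bar R) :
  measurable D ->
  \int[leb R k.+1]_(z in D) f z = \int[@sfleb 0 \x @sfleb k]_(z in D) f z.
Proof. by move=> mD; apply: eq_measure_integral => A mA _; rewrite /= product_sflebE. Qed.

Section tonelli.
Variables (i j : nat) (A : set (car R i)) (B : set (car R j)).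
Variable f : car R i * car R j -> \bar R.
Hypotheses (mA : measurable A) (mB : measurable B).
Hypotheses (mf : measurable_fun setT f) (f0 : forall z, 0 <= f z).

Lemma measurable_leb_xsection D : measurable_fun D (fun z => \int[leb R j]_(w in B) f (z, w)).
Proof. exact: (measurable_integral_xsection (@sfleb j) mB mf f0). Qed.

Lemma leb_tonelli_exchange :
  \int[leb R i]_(z in A) \int[leb R j]_(w in B) f (z, w) =
  \int[leb R j]_(w in B) \int[leb R i]_(z in A) f (z, w).
Proof. exact: (tonelli_setX (@sfleb i) (@sfleb j)). Qed.

End tonelli.

Lemma iterated_integral_le_add i j (A : set (car R i)) (B : set (car R j))
    (f g h : car R i * car R j -> \bar R) : measurable A -> measurable B ->
  measurable_fun setT f -> measurable_fun setT g -> measurable_fun setT h ->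
  (forall p, 0 <= f p) -> (forall p, 0 <= g p) -> (forall p, 0 <= h p) ->
  (forall p, h p <= f p + g p) ->
  \int[leb R i]_(z in A) \int[leb R j]_(w in B) h (z, w) <=
  \int[leb R i]_(z in A) \int[leb R j]_(w in B) f (z, w) +
  \int[leb R i]_(z in A) \int[leb R j]_(w in B) g (z, w).
Proof.
move=> mA mB mf mg mh f0 g0 h0 hfg.
have m_section (u : car R i * car R j -> \bar R) z :
    measurable_fun setT u -> measurable_fun B (fun w => u (z, w)).
  by move=> mu; apply: measurable_funTS; exact: (measurableT_comp mu (pair1_measurable z)).
have m_int u mu u0 := @measurable_leb_xsection i j B u mB mu u0 A.
have int_ge0 (u : car R i * car R j -> \bar R) z : (forall p, 0 <= u p) ->
    0 <= \int[leb R j]_(w in B) u (z, w) by move=> u0; apply: integral_ge0.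
rewrite -ge0_integralD//; try exact: m_int; try by move=> z _; exact: int_ge0.
apply: ge0_le_integral => //; try by move=> z _; exact: int_ge0.
- exact: m_int.
- by apply: emeasurable_funD; exact: m_int.
move=> z _; rewrite -ge0_integralD//; try exact: m_section.
apply: ge0_le_integral => //; first exact: m_section.
by apply: emeasurable_funD; exact: m_section.
Qed.

Lemma leb_tonelli_setX k (A : set (car R 0)) (B : set (car R k)) (f : car R k.+1 -> \bar R) :
  measurable A -> measurable B -> measurable_fun setT f -> (forall z, 0 <= f z) ->
  \int[leb R k.+1]_(z in A `*` B) f z = \int[leb R 0]_(t in A) \int[leb R k]_(x in B) f (t, x).
Proof.
move=> mA mB mf f0; rewrite integral_product_sflebE; last exact: measurableX.
exact: (tonelli1_setX (@sfleb 0) (@sfleb k)).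
Qed.

Lemma leb_tonelli k (f : car R k.+1 -> \bar R) :
  measurable_fun setT f -> (forall z, 0 <= f z) ->
  \int[leb R k.+1]_z f z = \int[leb R 0]_t \int[leb R k]_x f (t, x).
Proof. by move=> mf f0; rewrite -setXTT leb_tonelli_setX. Qed.

Section fubini.
Variables (k : nat) (f : car R k.+1 -> \bar R).
Hypothesis intf : (leb R k.+1).-integrable setT f.

Let intf_product : (@sfleb 0 \x @sfleb k).-integrable setT f.
Proof.
have /integrableP[mf foo] := intf; apply/integrableP; split => //.
by rewrite -integral_product_sflebE.
Qed.

Lemma leb_fubini : \int[leb R k.+1]_z f z = \int[leb R 0]_t \int[leb R k]_x f (t, x).
Proof. by rewrite integral_product_sflebE// -(integral12_prod_meas1 intf_product). Qed.

Lemma leb_fubini_integrable :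
  (leb R 0).-integrable setT (fun t => \int[leb R k]_x f ((t : R), x)).
Proof. exact: (integrable_fubini_F intf_product). Qed.

Lemma leb_fubini_ae :
  {ae lebesgue_measure, forall t : measurableTypeR R,
    (leb R k).-integrable setT (fun x => f (t, x))}.
Proof. exact: (ae_integrable1 intf_product). Qed.

End fubini.

End lebesgue_product.

Section dilation.
Context {R : realType}.
Implicit Types k : nat.
Local Open Scope ereal_scope.

Lemma preimage_dil_itv (w : car R 0) (s a b : R) : (0 < s)%R ->
  dil w s @^-1` `]a, b] = `]((w : R) + (a - w) / s)%R, ((w : R) + (b - w) / s)%R]%classic.
Proof.
move=> s0; apply/seteqP; split => x; rewrite /dil/subv/= !in_itv/= mulN1r;
  by rewrite -ltrBrDl -lerBlDl ltr_pdivrMr// ler_pdivlMr// mulrC -ltrBlDl -lerBrDl.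
Qed.

Lemma lebesgue_measure_dil (w : car R 0) (s : R) (A : set (car R 0)) : (0 < s)%R ->
  measurable A -> leb R 0 (dil w s @^-1` A) = s^-1%:E * leb R 0 A.
Proof.
move=> s0 mA; pose d : measurableTypeR R -> measurableTypeR R := dil w s.
have md : measurable_fun setT d := @measurable_dil R 0 w s.
suff pushE : forall B, measurable B -> lebesgue_measure B =
    mscale (NngNum (ltW s0)) (pushforward lebesgue_measure d) B.
  by rewrite [X in _ * X](pushE md _ mA) /mscale/= muleA -EFinM mulVf ?gt_eqF// mul1e.
move=> m_d B mB; apply: lebesgue_measure_unique mB => _ [[a b] _ <-].
rewrite /= /mscale/= /pushforward preimage_dil_itv// !lebesgue_measure_itv/=.
rewrite !lte_fin ltrD2l ltr_pM2r ?invr_gt0// ltrD2r.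
case: ifP => _; last by rewrite mule0.
by rewrite -!EFinB -EFinM; congr EFin; field; rewrite gt_eqF.
Qed.

Let ge0_integral_dil0 (w : car R 0) (s : R) (f : car R 0 -> \bar R) : (0 < s)%R ->
  measurable_fun setT f -> (forall x, 0 <= f x) ->
  \int[leb R 0]_x f (dil w s x) = s^-1%:E * \int[leb R 0]_x f x.
Proof.
move=> s0 mf f0; have sV0 : (0 <= s^-1)%R by rewrite invr_ge0 ltW.
have md := @measurable_dil R 0 w s.
rewrite -(ge0_integral_mscale _ measurableT (NngNum sV0))//.
rewrite -[LHS](ge0_integral_pushforward md (leb R 0) measurableT mf)//.
by apply: eq_measure_integral => A mA _; exact: lebesgue_measure_dil.
Qed.

Lemma ge0_integral_dil k (w : car R k) (s : R) (f : car R k -> \bar R) : (0 < s)%R ->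
  measurable_fun setT f -> (forall x, 0 <= f x) ->
  \int[leb R k]_x f (dil w s x) = (s^-1 ^+ k.+1)%:E * \int[leb R k]_x f x.
Proof.
move=> s0; elim: k w f => [|k IH] w f mf f0; first by rewrite expr1 ge0_integral_dil0.
have m_int := @measurable_leb_xsection R 0 k setT f measurableT mf f0 setT.
rewrite leb_tonelli//; last exact: (measurableT_comp mf (measurable_dil w s)).
under eq_integral => t _.
  rewrite (IH w.2 (fun x => f ((dil (w.1 : car R 0) s (t : R) : R), x)))//; last first.
    exact: (measurableT_comp mf (pair1_measurable _)).
  over.
rewrite ge0_integralZl//; last 3 first.
- exact: (measurableT_comp m_int (@measurable_dil R 0 w.1 s)).
- by move=> t _; apply: integral_ge0.
- by rewrite lee_fin exprn_ge0// invr_ge0 ltW.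
rewrite (ge0_integral_dil0 w.1 s0 m_int); last by move=> t; apply: integral_ge0.
by rewrite -leb_tonelli// muleA -EFinM -exprSr.
Qed.

Lemma leb_eball_scale k (x0 : car R k) (r s : R) : (0 < r)%R -> (0 < s)%R ->
  leb R k (eball x0 (s * r)) = (s ^+ k.+1)%:E * leb R k (eball x0 r).
Proof.
move=> r0 s0; have sV0 : (0 < s^-1)%R by rewrite invr_gt0.
have mB := measurable_eball x0 r0; have mBs := measurable_eball x0 (mulr_gt0 s0 r0).
rewrite -(setIT (eball x0 (s * r))) -(setIT (eball x0 r)) -!integral_indic//.
rewrite -[s in RHS]invrK -(ge0_integral_dil x0 sV0); last by move=> x; rewrite lee_fin.
  apply: eq_integral => x _; congr EFin; rewrite !indicE; congr (_%:R); congr nat_of_bool.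
  apply/idP/idP; rewrite !inE /eball/= subv_dil enormZ (gtr0_norm sV0);
    by rewrite ltr_pdivrMl.
by apply/measurable_EFinP; exact: measurable_indic.
Qed.

Section space_time.
Variables (k : nat) (w : car R k) (s : R).
Hypothesis s0 : (0 < s)%R.

Lemma ge0_integral_xdil (f : car R k.+1 -> \bar R) :
  measurable_fun setT f -> (forall x, 0 <= f x) ->
  \int[leb R k.+1]_z f (xdil w s z) = (s^-1 ^+ k.+1)%:E * \int[leb R k.+1]_z f z.
Proof.
move=> mf f0.
rewrite leb_tonelli//; last exact: (measurableT_comp mf (measurable_xdil w s)).
under eq_integral => t _.
  rewrite (ge0_integral_dil w s0 (f := fun x => f ((t : R), x)))//; last first.
    exact: (measurableT_comp mf (pair1_measurable _)).
  over.
rewrite ge0_integralZl//; last 3 first.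
- exact: (@measurable_leb_xsection R 0 k setT f measurableT mf f0 setT).
- by move=> t _; apply: integral_ge0.
- by rewrite lee_fin exprn_ge0// invr_ge0 ltW.
by rewrite leb_tonelli.
Qed.

Variable f : car R k.+1 -> R.
Hypothesis intf : (leb R k.+1).-integrable setT (EFin \o f).

Lemma integrable_xdil : (leb R k.+1).-integrable setT (EFin \o (fun z => f (xdil w s z))).
Proof.
have /integrableP[mf f_fin] := intf; apply/integrableP; split.
  exact: (measurableT_comp mf (measurable_xdil w s)).
rewrite (ge0_integral_xdil (f := fun z => `|(f z)%:E|%E))//; last exact: measurableT_comp.
by rewrite lte_mul_pinfty// lee_fin exprn_ge0// invr_ge0 ltW.
Qed.

Lemma Rintegral_xdil :
  (\int[leb R k.+1]_z f (xdil w s z) = s^-1 ^+ k.+1 * \int[leb R k.+1]_z f z)%R.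
Proof.
have mf := measurable_int _ intf.
rewrite /Rintegral integralE [in RHS]integralE.
rewrite -/((EFin \o f) \o xdil w s) funepos_comp funeneg_comp.
rewrite !ge0_integral_xdil//; [|exact: measurable_funeneg|exact: measurable_funepos].
rewrite -muleBr ?fineM//; last first.
  by apply: fin_num_adde_defr; exact: integrable_pos_fin_num.
by rewrite fin_numB integrable_pos_fin_num// integrable_neg_fin_num.
Qed.

End space_time.

End dilation.

(** * Duality between [L^1] and test functions *)

Section integrability.
Context {R : realType} d (T : measurableType d) (mu : {measure set T -> \bar R}).
Variables (D : set T) (mD : measurable D).

Lemma integrable_mulr_bounded (f h : T -> R) (C : R) :
  mu.-integrable D (EFin \o f) -> measurable_fun D h ->
  (forall z, D z -> `|h z| <= C) -> mu.-integrable D (EFin \o (fun z => f z * h z)).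
Proof.
move=> intf mh hC.
have bounded_h : [bounded h z | z in D].
  exists C; split => [|M CM z Dz /=]; first exact: num_real.
  by rewrite (le_trans (hC z Dz))// ltW.
by rewrite (_ : EFin \o _ = (EFin \o f) \* (EFin \o h))%E//; exact: integrableMl.
Qed.

Lemma integrable_measurable_fun (f : T -> R) : mu.-integrable D (EFin \o f) -> measurable_fun D f.
Proof. by move=> intf; apply/measurable_EFinP; exact: measurable_int intf. Qed.

Lemma integrable_patch (f : T -> R) : mu.-integrable D (EFin \o f) ->
  mu.-integrable setT (EFin \o (f \_ D)).
Proof.
move=> intf; have := (integrable_restrict mu mD measurableT (EFin \o f)).1.
by rewrite setTI restrict_EFin; apply.
Qed.

Lemma measurable_patch (f : T -> R) : mu.-integrable D (EFin \o f) ->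
  measurable_fun setT (f \_ D).
Proof.
by move=> intf; apply/(measurable_restrictT _ mD); exact: integrable_measurable_fun.
Qed.

Lemma fineK_integral (f : T -> R) : mu.-integrable D (EFin \o f) ->
  (\int[mu]_(z in D) (f z)%:E)%E = (\int[mu]_(z in D) f z)%:E.
Proof. by move=> intf; rewrite fineK//; exact: integrable_fin_num intf. Qed.

Lemma Rintegral_sum n (f : 'I_n -> T -> R) :
  (forall i, mu.-integrable D (EFin \o f i)) ->
  \int[mu]_(z in D) (\sum_(i < n) f i z) = \sum_(i < n) \int[mu]_(z in D) f i z.
Proof.
move=> intf; rewrite /Rintegral.
under eq_integral do rewrite -sumEFin.
rewrite (integral_sum mD intf) -sum_fine//.
by move=> i _; exact: integrable_fin_num.
Qed.

Lemma Rintegral_norm_le (f F : T -> R) :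
  mu.-integrable D (EFin \o f) -> mu.-integrable D (EFin \o F) ->
  (forall z, D z -> `|f z| <= F z) -> `|\int[mu]_(z in D) f z| <= \int[mu]_(z in D) F z.
Proof.
move=> intf intF fF; apply: le_trans (le_normr_Rintegral mD intf) _.
by apply: le_Rintegral => //; exact: integrable_abse intf.
Qed.

Lemma integral_dist_triangle (f g h : T -> R) :
  measurable_fun D f -> measurable_fun D g -> measurable_fun D h ->
  (\int[mu]_(z in D) (`|f z - h z|)%:E <=
   \int[mu]_(z in D) (`|f z - g z|)%:E + \int[mu]_(z in D) (`|g z - h z|)%:E)%E.
Proof.
move=> mf mg mh; have m_dist (u v : T -> R) : measurable_fun D u -> measurable_fun D v ->
    measurable_fun D (fun z => (`|u z - v z|)%:E).
  by move=> m_u m_v; apply/measurable_EFinP/measurableT_comp => //; exact: measurable_funB.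
rewrite -ge0_integralD//; try exact: m_dist.
apply: ge0_le_integral => //; [exact: m_dist|by apply: emeasurable_funD; exact: m_dist|].
by move=> z _; rewrite -EFinD lee_fin -[X in `|X|](subrKA (g z)) ler_normD.
Qed.

End integrability.

Section halfspaces.
Context {R : realType} (k : nat).

Lemma measurable_halfspace (v : car R k) (c : R) : measurable [set z | c < dotv z v].
Proof.
have := measurable_dotv v measurableT (measurable_itv `]c, +oo[).
by rewrite setTI; congr measurable; apply/seteqP; split => z /=; rewrite in_itv/= andbT.
Qed.

Lemma halfspaces_generate (G : set (set (car R k))) : sigma_algebra setT G ->
  (forall v c, G [set z | c < dotv z v]) -> measurable `<=` G.
Proof.
move=> sG Ghalf E mE.
have GE : <<s G >> = G := sigma_algebra_id sG.
have m_id : measurable_fun setT (id : g_sigma_algebraType G -> car R k).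
  apply: measurable_fun_dotv => v.
  apply: (measurability _ (RGenOInfty.measurableE R)) => _ [_ [c ->] <-].
  rewrite setTI (_ : _ @^-1` _ = [set z | c < dotv z v]); first exact: sub_gen_smallest.
  by apply/seteqP; split => z /=; rewrite in_itv/= andbT.
by have := m_id measurableT _ mE; rewrite setTI preimage_id /measurable/= GE.
Qed.

End halfspaces.

Section L1_duality.
Context {R : realType} (k : nat) (mu : {measure set (car R k) -> \bar R}).
Variables (D : set (car R k)) (mD : measurable D) (Phi : car R k -> R).
Hypothesis intPhi : mu.-integrable D (EFin \o Phi).
Implicit Types (f g h : car R k -> R).

Let mPhi : measurable_fun D Phi.
Proof. exact: integrable_measurable_fun intPhi. Qed.

Let int_normPhi : mu.-integrable D (fun z => `|Phi z|%:E) := integrable_abse intPhi.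

Let wdist f g : \bar R := \int[mu]_(z in D) (`|Phi z| * `|f z - g z|)%:E.

Let measurable_wdist f g : measurable_fun setT f -> measurable_fun setT g ->
  measurable_fun D (fun z => (`|Phi z| * `|f z - g z|)%:E).
Proof.
move=> mf mg; apply/measurable_EFinP/measurable_funM; first exact: measurableT_comp.
by apply: measurable_funTS; apply: measurableT_comp => //; exact: measurable_funB.
Qed.

Let wdist_le f g f1 g1 f2 g2 :
  measurable_fun setT f -> measurable_fun setT g ->
  measurable_fun setT f1 -> measurable_fun setT g1 ->
  measurable_fun setT f2 -> measurable_fun setT g2 ->
  (forall z, `|f z - g z| <= `|f1 z - g1 z| + `|f2 z - g2 z|) ->
  (wdist f g <= wdist f1 g1 + wdist f2 g2)%E.
Proof.
move=> mf mg mf1 mg1 mf2 mg2 fg; rewrite /wdist -ge0_integralD//; try exact: measurable_wdist.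
apply: ge0_le_integral => //; first exact: measurable_wdist.
  by apply: emeasurable_funD; exact: measurable_wdist.
by move=> z Dz; rewrite -EFinD lee_fin -mulrDr ler_wpM2l.
Qed.

Let in01 f := forall z, 0 <= f z <= 1.

Let wdist_lt f (f_ : nat -> car R k -> R) (e : R) :
  measurable_fun setT f -> (forall n, measurable_fun setT (f_ n)) -> (forall n, in01 (f_ n)) ->
  (forall z, D z -> f_ n z @[n --> \oo] --> f z) -> 0 < e ->
  exists n, (wdist f (f_ n) < e%:E)%E.
Proof.
move=> mf mf_ f_01 cf e0.
have [|||||_ + _] := @dominated_convergence _ _ _ mu D mD
    (fun n z => (Phi z * f_ n z)%:E) (fun z => (Phi z * f z)%:E) (fun z => `|Phi z|%:E).
- by move=> n; apply/measurable_EFinP/measurable_funM => //; exact: measurable_funTS.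
- by apply/measurable_EFinP/measurable_funM => //; exact: measurable_funTS.
- by apply: aeW => z Dz; apply: cvg_EFin; [exact: nearW|by apply: cvgM; [exact: cvg_cst|exact: cf]].
- exact: int_normPhi.
- apply: aeW => z n Dz; rewrite lee_fin normrM ler_piMr//.
  by have /andP[f0 f1] := f_01 n z; rewrite ger0_norm.
rewrite (_ : [sequence _]_n = fun n => wdist f (f_ n)); last first.
  apply/funext => n; apply: eq_integral => z _.
  by rewrite -EFinB -mulrBr abse_EFin normrM distrC.
move=> /fine_cvgP[dist_fin /cvgr0_norm_lt/(_ _ e0) dist_e].
have [n [n_fin n_e]] := filter_ex (filterI dist_fin dist_e).
by exists n; rewrite -(fineK n_fin) lte_fin (le_lt_trans (ler_norm _)).
Qed.

Let tame_approx f := [/\ measurable_fun setT f, in01 f &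
  forall e : R, 0 < e -> exists g, [/\ tame g, in01 g & (wdist f g < e%:E)%E]].

Let tame_approx_tame f : tame f -> in01 f -> tame_approx f.
Proof.
move=> tf f01; split=> // [|e e0]; first exact: tame_measurable.
exists f; split => //; rewrite /wdist integral0_eq ?lte_fin// => z _.
by rewrite subrr normr0 mulr0.
Qed.

Let tame_approxC f : tame_approx f -> tame_approx (fun z => 1 - f z).
Proof.
move=> [mf f01 approx_f]; split=> [|z|e /approx_f[g [tg g01 fg]]].
- by apply: measurable_funB => //; exact: measurable_cst.
- by have /andP[f0 f1] := f01 z; rewrite subr_ge0 f1 gerBl.
exists (fun z => 1 - g z); split.
- by apply: tameB => //; exact: tame_cst.
- by move=> z; have /andP[g0 g1] := g01 z; rewrite subr_ge0 g1 gerBl.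
apply: le_lt_trans fg; rewrite le_eqVlt; apply: predU1l.
by apply: eq_integral => z _; rewrite distrC; congr (_ * `|_|)%:E; ring.
Qed.

Let tame_approxM f1 f2 : tame_approx f1 -> tame_approx f2 -> tame_approx (fun z => f1 z * f2 z).
Proof.
move=> [mf1 f101 approx_f1] [mf2 f201 approx_f2].
have in01M g1 g2 : in01 g1 -> in01 g2 -> in01 (fun z => g1 z * g2 z).
  move=> g101 g201 z; have /andP[? ?] := g101 z; have /andP[? ?] := g201 z.
  by rewrite mulr_ge0//= mulr_ile1.
split=> [||e e0]; [exact: measurable_funM|exact: in01M|].
have e2 : 0 < e / 2 by rewrite divr_gt0.
have [g1 [tg1 g101 fg1]] := approx_f1 _ e2; have [g2 [tg2 g201 fg2]] := approx_f2 _ e2.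
exists (fun z => g1 z * g2 z); split; [exact: tameM|exact: in01M|].
rewrite (splitr e) EFinD; apply: le_lt_trans (lteD fg1 fg2).
apply: wdist_le => [||//||//||z].
- exact: measurable_funM.
- by apply: tame_measurable; exact: tameM.
- exact: tame_measurable.
- exact: tame_measurable.
have /andP[f0 f_le1] := f201 z; have /andP[g0 g_le1] := g101 z.
rewrite (_ : _ - _ = (f1 z - g1 z) * f2 z + g1 z * (f2 z - g2 z)); last by ring.
rewrite (le_trans (ler_normD _ _))// !normrM (ger0_norm f0) (ger0_norm g0).
by rewrite lerD// (ler_piMr, ler_piMl).
Qed.

Let tame_approx_lim f (f_ : nat -> car R k -> R) : measurable_fun setT f -> in01 f ->
  (forall n, tame_approx (f_ n)) -> (forall z, D z -> f_ n z @[n --> \oo] --> f z) ->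
  tame_approx f.
Proof.
move=> mf f01 approx_f cf; split=> // e e0; have e2 : 0 < e / 2 by rewrite divr_gt0.
have mf_ n : measurable_fun setT (f_ n) by have [] := approx_f n.
have f_01 n : in01 (f_ n) by have [] := approx_f n.
have [n fn_close] : exists n, (wdist f (f_ n) < (e / 2)%:E)%E by exact: wdist_lt.
have [_ _ /(_ _ e2)[g [tg g01 fg]]] := approx_f n.
exists g; split => //; rewrite (splitr e) EFinD.
apply: le_lt_trans (lteD fn_close fg).
apply: wdist_le => //; try exact: tame_measurable.
by move=> z; rewrite -[X in `|X|](subrKA (f_ n z)) ler_normD.
Qed.

Let in01_indic (A : set (car R k)) : in01 \1_A.
Proof. by move=> z; rewrite indicE; case: (z \in A); rewrite ?lexx ?ler01. Qed.

Let tame_approx_halfspace v c : tame_approx \1_[set z | c < dotv z v].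
Proof.
pose f_ n (z : car R k) := expNV (n.+1%:R * (dotv z v - c) - 1).
apply: (@tame_approx_lim _ f_) => [|//|n|z _]; first exact/measurable_indic/measurable_halfspace.
  apply: tame_approx_tame; last by move=> z; rewrite expNV_ge0 expNV_le1.
  apply: tame_expNV; apply: tameB; last exact: tame_cst.
  by apply: tameZ; apply: tameB; [exact: tame_dotv|exact: tame_cst].
have [cz|cz] := ltP c (dotv z v).
  by rewrite indicE mem_set//; apply: expNV_cvg1; rewrite subr_gt0.
rewrite indicE memNset/=; last by apply/negP; rewrite -leNgt.
apply: cvg_near_cst; apply: nearW => n; rewrite /f_ expNV_eq0//.
by rewrite subr_le0 (le_trans _ ler01)// mulr_ge0_le0// subr_le0.
Qed.

Let tame_approx_bigcup (F : nat -> set (car R k)) : nondecreasing_seq F ->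
  (forall n, measurable (F n)) -> (forall n, tame_approx \1_(F n)) ->
  tame_approx \1_(\bigcup_n F n).
Proof.
move=> ndF mF aF; apply: (@tame_approx_lim _ (fun n => \1_(F n))) => // [|z _].
  by apply: measurable_indic; exact: bigcup_measurable.
have [[i _ Fiz]|nFz] := pselect ((\bigcup_n F n) z).
  rewrite indicE mem_set; last by exists i.
  apply: cvg_near_cst; near=> n; rewrite indicE mem_set//.
  have in_le : (i <= n)%N by near: n; exact: nbhs_infty_ge.
  by have /subsetPset := ndF _ _ in_le; apply.
rewrite indicE memNset//; apply: cvg_near_cst; apply: nearW => n.
by rewrite indicE memNset// => Fnz; apply: nFz; exists n.
Unshelve. all: by end_near. Qed.

Let tame_approx_indic E : measurable E -> tame_approx \1_E.
Proof.
pose G (A : set (car R k)) := measurable A /\ tame_approx \1_A.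
suff sG : sigma_algebra setT G.
  move=> mE; suff [] : G E by [].
  apply: halfspaces_generate mE => // v c.
  by split; [exact: measurable_halfspace|exact: tame_approx_halfspace].
apply/sigma_algebraP => //; split.
- split=> //; rewrite indicT; apply: tame_approx_tame; first exact: tame_cst.
  by move=> z; rewrite ler01 lexx.
- move=> A B _ [mA aA] [mB aB]; split; first exact: measurableD.
  rewrite (_ : \1__ = fun z => \1_A z * (1 - \1_B z)).
    by apply: tame_approxM => //; exact: tame_approxC.
  by apply/funext => z; rewrite !indicE in_setD; case: (z \in A); case: (z \in B) => /=; ring.
- move=> F ndF GF; have mF n : measurable (F n) by have [] := GF n.
  split; first exact: bigcup_measurable.
  by apply: tame_approx_bigcup => // n; have [] := GF n.
- move=> A B [mA aA] [mB aB]; split; first exact: measurableI.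
  rewrite (_ : \1__ = fun z => \1_A z * \1_B z); first exact: tame_approxM.
  by apply/funext => z; rewrite !indicE in_setI; case: (z \in A); case: (z \in B) => /=; ring.
Qed.

Let nnegPhi := D `&` [set z | 0 <= Phi z].

Let sgPhi (z : car R k) : R := 2 * \1_nnegPhi z - 1.

Let normr_sgPhi z : D z -> `|Phi z| = Phi z * sgPhi z.
Proof.
move=> Dz; rewrite /sgPhi indicE; have [Phi0|Phi0] := leP 0 (Phi z).
  by rewrite mem_set// ger0_norm//=; ring.
rewrite memNset; last by move=> [_ /=]; rewrite leNgt Phi0.
by rewrite ltr0_norm//=; ring.
Qed.

Let measurable_nnegPhi : measurable nnegPhi.
Proof.
have := mPhi mD (measurable_itv `[0, +oo[).
congr measurable; congr (_ `&` _).
by apply/seteqP; split => z /=; rewrite in_itv/= andbT.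
Qed.

Let measurable_sgPhi : measurable_fun setT sgPhi.
Proof.
apply: measurable_funB; last exact: measurable_cst.
by apply: measurable_funM; [exact: measurable_cst|exact: measurable_indic].
Qed.

Let L1_norm_le_pairing h : measurable_fun setT h -> (forall z, `|h z| <= 1) ->
  (\int[mu]_(z in D) (`|Phi z|)%:E <=
   `|\int[mu]_(z in D) (Phi z * h z)%:E| + wdist sgPhi h)%E.
Proof.
move=> mh h1; have sg1 z : `|sgPhi z| <= 1.
  have /andP[? ?] := in01_indic nnegPhi z.
  by rewrite ler_norml /sgPhi; apply/andP; split; lra.
have int_Phih : mu.-integrable D (EFin \o (fun z => Phi z * h z)).
  by apply: (integrable_mulr_bounded mD intPhi _ (fun z _ => h1 z)); exact: measurable_funTS.
have int_defect : mu.-integrable D (fun z => (`|Phi z| * `|sgPhi z - h z|)%:E).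
  apply: (integrable_mulr_bounded (C := 2) mD int_normPhi).
    by apply: measurable_funTS; apply: measurableT_comp => //; exact: measurable_funB.
  by move=> z _; rewrite normr_id (le_trans (ler_normB _ _))// -[2]/(1 + 1) lerD.
apply: le_trans (leeD2r _ (lee_abs _)); rewrite -integralD//.
apply: le_integral => //; first exact: integrableD.
move=> z /[!inE] Dz; rewrite -EFinD lee_fin [leLHS]normr_sgPhi//.
rewrite -lerBlDl -mulrBr -normrM; exact: ler_norm.
Qed.

Lemma L1_norm_le_dual (M : \bar R) : has_cutoffs D ->
  (forall h, tame h -> compact_support_in D h -> (forall z, `|h z| <= 1) ->
    (`|\int[mu]_(z in D) (Phi z * h z)%:E| <= M)%E) ->
  (\int[mu]_(z in D) (`|Phi z|)%:E <= M)%E.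
Proof.
move=> [b [tb sb b01 cb]] pairing_le; apply/lee_addgt0Pr => e e0.
have e3 : 0 < e / 3 by rewrite divr_gt0.
have [_ _ /(_ _ e3)[f [tf f01 fe]]] := tame_approx_indic measurable_nnegPhi.
have [n bn_lt] : exists n, (wdist (fun=> 1%R) (b n) < (e / 3)%:E)%E.
  by apply: wdist_lt => // n; exact: tame_measurable.
pose s z := 2 * f z - 1; pose h z := s z * b n z.
have ts : tame s by apply: tameB; [exact: tameZ|exact: tame_cst].
have th : tame h by exact: tameM.
have s1 z : `|s z| <= 1.
  by have /andP[? ?] := f01 z; rewrite ler_norml /s; apply/andP; split; lra.
have bn1 z : `|b n z| <= 1 by have /andP[? ?] := b01 n z; rewrite ger0_norm.
have h1 z : `|h z| <= 1 by rewrite normrM mulr_ile1.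
have dist_s : (wdist sgPhi s <= wdist \1_nnegPhi f + wdist \1_nnegPhi f)%E.
  apply: wdist_le => // [|||z]; try exact: measurable_indic; try exact: tame_measurable.
  rewrite (_ : _ - _ = (\1_nnegPhi z - f z) + (\1_nnegPhi z - f z)); first exact: ler_normD.
  by rewrite /sgPhi /s; ring.
have dist_h : (wdist sgPhi h <= wdist (fun=> 1%R) (b n) + wdist sgPhi s)%E.
  apply: wdist_le => // [|||z]; try exact: tame_measurable.
  rewrite (_ : _ - _ = s z * (1 - b n z) + (sgPhi z - s z)); last by rewrite /h; ring.
  by rewrite (le_trans (ler_normD _ _))// lerD2r normrM ler_piMl.
apply: le_trans (L1_norm_le_pairing (tame_measurable th) h1) _.
apply: leeD; first by apply: pairing_le => //; exact: compact_supportM.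
rewrite (_ : e = e / 3 + (e / 3 + e / 3)); last by field.
by rewrite !EFinD (le_trans dist_h)// leeD ?(le_trans dist_s)// ?leeD// ltW.
Qed.

End L1_duality.

(** * Dilations and the weak gradient *)

Section differentiation_under_the_integral.
Context {R : realType} d (T : measurableType d) (mu : {measure set T -> \bar R}).
Variables (D : set T) (mD : measurable D) (F F' : R -> T -> R) (G : T -> R) (u v : R).

Lemma is_derive_Rintegral (s : R) : u < s < v ->
  (forall x, u < x < v -> mu.-integrable D (EFin \o F x)) ->
  (forall x z, is_derive x (1 : R) (F^~ z) (F' x z)) ->
  mu.-integrable D (EFin \o G) ->
  (forall x z, u < x < v -> D z -> `|F' x z| <= G z) ->
  is_derive s (1 : R) (fun x => \int[mu]_(z in D) F x z) (\int[mu]_(z in D) F' s z).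
Proof.
move=> suv intF dF intG F'G.
have uvE x : (`]u, v[%classic : set R) x -> u < x < v by rewrite /= in_itv.
have Is : (`]u, v[%classic : set R) s by rewrite /= in_itv.
have F'E x z : partial1of2 F x z = F' x z by rewrite partial1of2E; have [] := dF x z.
have dF_uv x z : (`]u, v[%classic : set R) x -> D z -> derivable (F^~ z) x 1.
  by move=> _ _; have [] := dF x z.
have F'_le x z : (`]u, v[%classic : set R) x -> D z -> `|partial1of2 F x z| <= `|G z|.
  by move=> /uvE xuv Dz; rewrite F'E (le_trans (F'G x z xuv Dz))// ler_norm.
have intF_uv x (Ix : (`]u, v[%classic : set R) x) := intF x (uvE x Ix).
have G0 z : 0 <= `|G z| by [].
have dH := derivable_under_integral mD Is intF_uv dF_uv G0 (integrable_abse intG) F'_le.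
have eH := differentiation_under_integral mD Is intF_uv dF_uv G0 (integrable_abse intG) F'_le.
apply: (DeriveDef dH); rewrite -derive1E [LHS]eH.
by apply: eq_Rintegral => z _; exact: F'E.
Qed.

End differentiation_under_the_integral.

Section directional_derivatives.
Context {R : realType}.
Implicit Types k : nat.

Lemma is_derive_translate (f : R -> R) (t l : R) :
  is_derive (0 : R) (1 : R) (fun s => f (t + s)) l -> is_derive t (1 : R) f l.
Proof.
move=> df; have dt : is_derive t (1 : R) (shift (- t)) 1 by exact: is_derive_shift.
have df0 : is_derive (shift (- t) t) (1 : R) (fun s => f (t + s)) l by rewrite /= subrr.
have := is_derive1_comp df0 dt.
by rewrite mulr1; congr is_derive; apply/funext => u /=; rewrite addrC subrK.
Qed.

Lemma dirder_val k (f : car R k -> R) z v l :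
  is_derive (0 : R) (1 : R) (fun s => f (addv z (scalev s v))) l -> dirder f z v = l.
Proof. by move=> fl; rewrite /dirder derive1E; have [] := fl. Qed.

Lemma dirderM k (f g : car R k -> R) z v : tame f -> tame g ->
  dirder (fun z => f z * g z) z v = f z * dirder g z v + g z * dirder f z v.
Proof.
move=> /tame_gradient[p _ fp] /tame_gradient[q _ gq].
by rewrite (is_gradient_dirder (is_gradientM fp gq)) (is_gradient_dirder fp)
  (is_gradient_dirder gq) !dotvE.
Qed.

Lemma dirder_dotv_snd k (w u v : car R k) (z : car R k.+1) :
  dirder (fun z : car R k.+1 => dotv (subv z.2 w) u) z (xvec v) = dotv v u.
Proof.
apply: dirder_val; have := is_gradient_dotv u (subv z.2 w) v.
rewrite (dotvC u v); congr is_derive; apply/funext => s /=; rewrite !dotvE; ring.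
Qed.

Lemma dirder_xdil k (w v : car R k) s (f : car R k.+1 -> R) z : tame f ->
  dirder (fun z => f (xdil w s z)) z (xvec v) = s * dirder f (xdil w s z) (xvec v).
Proof.
move=> tf; apply: dirder_val.
under eq_fun do rewrite xdil_line.
rewrite -dirderZ// (_ : scalev s (xvec v) = xvec (scalev s v)); first exact: is_derive_dirder.
by rewrite /xvec/= mulr0.
Qed.

Lemma sum_dirder_basisv k (f : car R k.+1 -> R) z (v : car R k) : tame f ->
  \sum_(i < k.+1) dotv v (basisv k i) * dirder f z (xvec (basisv k i)) = dirder f z (xvec v).
Proof.
move=> /tame_gradient[p _ fp].
have dirderE u : dirder f z (xvec u) = dotv u (p z).2.
  by rewrite (is_gradient_dirder fp) /= mulr0 add0r dotvC.
rewrite dirderE -sum_dotv_basisv; apply: eq_bigr => i _.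
by rewrite dirderE [dotv (basisv k i) _]dotvC.
Qed.

Lemma tame_dotv_snd k (w u : car R k) : tame (fun z : car R k.+1 => dotv (subv z.2 w) u).
Proof. exact: (tame_snd (tame_dotvB w u)). Qed.

End directional_derivatives.

Section bounded_domain.
Context {R : realType} (k : nat) (D : set (car R k)).
Hypotheses (mD : measurable D) (bD : ebounded D).

Lemma integrable_mulr_tame (f h : car R k -> R) :
  (leb R k).-integrable D (EFin \o f) -> tame h ->
  (leb R k).-integrable D (EFin \o (fun z => f z * h z)).
Proof.
move=> intf th; have [M DM] := bD; have [C hC] := tame_bounded M th.
apply: (integrable_mulr_bounded mD intf (tame_measurable th)) => z Dz.
by apply: hC; exact: DM.
Qed.

End bounded_domain.

Section weak_gradient.
Context {R : realType} (k : nat) (D : set (car R k.+1)).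
Let mu := leb R k.+1.
Hypothesis mD : measurable D.
Variables (a : car R k.+1 -> R) (g : car R k.+1 -> car R k).
Hypothesis wg : weak_gradx D a g.

Lemma integrable_enorm_grad : mu.-integrable D (EFin \o (fun z => enorm (g z))).
Proof. by have [_ []] := wg. Qed.

Lemma integrable_dotv_grad v : mu.-integrable D (EFin \o (fun z => dotv (g z) v)).
Proof.
have [mg _] := wg.
have int_enormM : mu.-integrable D (EFin \o (fun z => enorm v * enorm (g z))).
  exact: (integrableZl mD (enorm v) integrable_enorm_grad).
apply: le_integrable int_enormM => //; first exact/measurable_EFinP.
move=> z Dz; rewrite lee_fin (le_trans (normr_dotv_le _ _))//.
by rewrite mulrC ger0_norm// mulr_ge0// enorm_ge0.
Qed.

Lemma Rintegral_weak_gradx (phi : car R k.+1 -> R) (v : car R k) : Cc_infty D phi ->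
  \int[mu]_(z in D) (a z * dirder phi z (xvec v)) = - \int[mu]_(z in D) (dotv (g z) v * phi z).
Proof.
by have [_ [_ weak]] := wg => /(weak _ v) phiE; rewrite /Rintegral [X in fine X = _]phiE fineN.
Qed.

End weak_gradient.

Section star_shaped_domain.
Context {R : realType} (k : nat).
Variables (D : set (car R k.+1)) (w : car R k) (L : R).
Hypotheses (mD : measurable D) (bD : ebounded D).
Hypothesis starD : forall s z, 1 <= s -> D (xdil w s z) -> D z.
Hypothesis distD : forall z, D z -> enorm (subv z.2 w) <= L.
Let mu := leb R k.+1.
Variables (a : car R k.+1 -> R) (g : car R k.+1 -> car R k).
Hypotheses (inta : mu.-integrable D (EFin \o a)) (wg : weak_gradx D a g).

(* The divergence in space of [z |-> h z * (z.2 - w)]. *)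
Definition radial_div (h : car R k.+1 -> R) (z : car R k.+1) : R :=
  dirder h z (xvec (subv z.2 w)) + k.+1%:R * h z.

Lemma tame_radial_div h : tame h -> tame (radial_div h).
Proof.
move=> th; apply: tameD; last exact: tameZ.
under eq_fun do rewrite -sum_dirder_basisv//.
by apply: tame_sum => i; apply: tameM; [exact: tame_dotv_snd|exact: tame_dirder].
Qed.

Lemma is_derive_radial_div h (s : R) z : tame h ->
  is_derive s (1 : R) (fun s => s ^+ k.+1 * h (xdil w s z)) (s ^+ k * radial_div h (xdil w s z)).
Proof.
move=> th.
have dh : is_derive s (1 : R) (fun s => h (xdil w s z))
    (dirder h (xdil w s z) (xvec (subv z.2 w))).
  apply: is_derive_translate; have := is_derive_dirder (xdil w s z) (xvec (subv z.2 w)) th.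
  by under eq_fun do rewrite -xdil_shift.
have dX : is_derive s (1 : R) (fun u : R => u ^+ k.+1) (k.+1%:R * s ^+ k).
  have := is_derive_poly ('X^(k.+1) : {poly R}) s.
  rewrite derivXn hornerMn hornerXn -mulr_natl.
  by congr is_derive; apply/funext => u; rewrite hornerXn.
apply: (is_derive_eq (is_deriveM dX dh)).
rewrite /GRing.scale/= /radial_div subv_dil.
rewrite (_ : xvec (scalev s _) = scalev s (xvec (subv z.2 w))); last by rewrite /xvec/= mulr0.
by rewrite dirderZ// exprS; ring.
Qed.

Section test_function.
Variable h : car R k.+1 -> R.
Hypotheses (th : tame h) (supph : compact_support_in D h) (h1 : forall z, `|h z| <= 1).

Let vfield s i (z : car R k.+1) := dotv (subv z.2 w) (basisv k i) * h (xdil w s z).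

Let tame_vfield s i : tame (vfield s i).
Proof. by apply: tameM; [exact: tame_dotv_snd|exact: tame_xdil]. Qed.

Let sum_dirder_vfield s z :
  \sum_(i < k.+1) dirder (vfield s i) z (xvec (basisv k i)) = radial_div h (xdil w s z).
Proof.
rewrite /radial_div -sum_dirder_basisv// subv_dil.
have -> : k.+1%:R * h (xdil w s z) = \sum_(i < k.+1) h (xdil w s z).
  by rewrite sumr_const card_ord mulr_natl.
rewrite -big_split; apply: eq_bigr => i _.
rewrite dirderM; [|exact: tame_dotv_snd|exact: tame_xdil].
rewrite dirder_xdil// dirder_dotv_snd dotv_basisv dotvZl /=; ring.
Qed.

Let sum_grad_vfield s z :
  \sum_(i < k.+1) dotv (g z) (basisv k i) * vfield s i z =
  dotv (g z) (subv z.2 w) * h (xdil w s z).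
Proof.
rewrite -[in RHS]sum_dotv_basisv mulr_suml.
by apply: eq_bigr => i _; rewrite /vfield mulrA.
Qed.

Let int_grad_vfield s i :
  mu.-integrable D (EFin \o (fun z => dotv (g z) (basisv k i) * vfield s i z)).
Proof. by apply: integrable_mulr_tame => //; exact: (integrable_dotv_grad mD wg). Qed.

Lemma Rintegral_radial_div s : 1 <= s ->
  \int[mu]_(z in D) (a z * radial_div h (xdil w s z)) =
  - \int[mu]_(z in D) (dotv (g z) (subv z.2 w) * h (xdil w s z)).
Proof.
move=> s1; have CcD i : Cc_infty D (vfield s i).
  split; first exact: tame_smooth.
  by apply: compact_supportM; apply: compact_support_xdil => // z; exact: starD.
under eq_Rintegral => z _ do rewrite -sum_dirder_vfield mulr_sumr.
under [in RHS]eq_Rintegral => z _ do rewrite -sum_grad_vfield.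
rewrite !Rintegral_sum// => [|i]; last first.
  by apply: integrable_mulr_tame => //; exact: tame_dirder.
by rewrite -sumrN; apply: eq_bigr => i _; exact: Rintegral_weak_gradx.
Qed.

Lemma normr_Rintegral_radial_div_le s : 1 <= s ->
  `|\int[mu]_(z in D) (a z * radial_div h (xdil w s z))| <= L * \int[mu]_(z in D) enorm (g z).
Proof.
move=> s1; have int_g := integrable_enorm_grad wg.
rewrite Rintegral_radial_div// normrN -RintegralZl//.
apply: Rintegral_norm_le => //.
- rewrite (_ : EFin \o _ = fun z =>
      (\sum_(i < k.+1) (dotv (g z) (basisv k i) * vfield s i z)%:E)%E).
    by apply: integrable_sum => // i _; exact: int_grad_vfield.
  by apply/funext => z; rewrite sumEFin sum_grad_vfield.
- exact: (integrableZl mD L int_g).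
- move=> z Dz; rewrite normrM (le_trans (ler_piMr _ (h1 _)))//.
  by rewrite (le_trans (normr_dotv_le _ _))// mulrC ler_wpM2r ?enorm_ge0 ?distD.
Qed.

Let radial_div_bounded (S : R) :
  exists C, forall s z, 0 < s < S -> D z -> `|s ^+ k * radial_div h (xdil w s z)| <= C.
Proof.
have [M DM] := bD.
have [C hC] := tame_bounded (M + (enorm w + S * (M + enorm w))) (tame_radial_div th).
exists (S ^+ k * C) => s z /andP[s0 sS] Dz; rewrite normrM normrX gtr0_norm//.
apply: ler_pM => //; first by rewrite exprn_ge0// ltW.
  by rewrite lerXn2r// ?nnegrE ltW// (lt_trans s0).
apply: hC; apply: le_trans (enorm_xdil_le _ _ _) _; rewrite gtr0_norm//.
apply: lerD; first exact: DM.
rewrite lerD2l ler_pM// ?(ltW s0) ?(ltW sS)// ?lerD2r ?DM//.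
by rewrite addr_ge0// enorm_ge0.
Qed.

Let scaled s (z : car R k.+1) : R := a z * (s ^+ k.+1 * h (xdil w s z)).

Let is_derive_pairing (s : R) : 0 < s ->
  is_derive s (1 : R) (fun s => \int[mu]_(z in D) scaled s z)
    (s ^+ k * \int[mu]_(z in D) (a z * radial_div h (xdil w s z))).
Proof.
move=> s0; have [C hC] := radial_div_bounded (s + 1).
rewrite -RintegralZl//; last first.
  by apply: integrable_mulr_tame => //; apply: tame_xdil; exact: tame_radial_div.
under eq_Rintegral => z _ do rewrite mulrCA.
apply: (@is_derive_Rintegral _ _ _ _ _ mD scaled
  (fun s z => a z * (s ^+ k * radial_div h (xdil w s z))) (fun z => `|a z| * C) 0 (s + 1)).
- by rewrite s0 ltrDl ltr01.
- by move=> u _; apply: integrable_mulr_tame => //; apply: tameZ; exact: tame_xdil.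
- by move=> u z; apply: is_deriveZ; exact: is_derive_radial_div.
- exact: (integrableZr mD C (integrable_abse inta)).
- by move=> u z us Dz; rewrite normrM ler_wpM2l// hC.
Qed.

Lemma dilation_pairing_le s : 1 <= s ->
  `|\int[mu]_(z in D) (a z * h z) - \int[mu]_(z in D) (a z * (s ^+ k.+1 * h (xdil w s z)))|
  <= s ^+ k * (s - 1) * (L * \int[mu]_(z in D) enorm (g z)).
Proof.
rewrite le_eqVlt => /predU1P[<-|s1].
  under [X in _ - X]eq_Rintegral => z _ do rewrite expr1n mul1r xdil1.
  by rewrite !subrr normr0 mulr0 mul0r.
have -> : \int[mu]_(z in D) (a z * h z) = \int[mu]_(z in D) scaled 1 z.
  by apply: eq_Rintegral => z _; rewrite /scaled expr1n mul1r xdil1.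
have pos u : 1 <= u -> 0 < u by exact: lt_le_trans.
have [||u] := @MVT R (fun s => \int[mu]_(z in D) scaled s z)
    (fun s => s ^+ k * \int[mu]_(z in D) (a z * radial_div h (xdil w s z))) 1 s s1.
- by move=> u; rewrite in_itv/= => /andP[/ltW/pos u0 _]; exact: is_derive_pairing.
- apply: derivable_within_continuous => u; rewrite in_itv/= => /andP[/pos u0 _].
  by have [] := is_derive_pairing u0.
rewrite in_itv/= => /andP[/ltW u1 /ltW us]; rewrite distrC => ->.
rewrite !normrM (ger0_norm (_ : 0 <= s - 1)) ?subr_ge0 ?(ltW s1)//.
rewrite [leRHS]mulrAC ler_wpM2r ?subr_ge0 ?(ltW s1)//.
apply: ler_pM => //; last exact: normr_Rintegral_radial_div_le.
by rewrite normrX gtr0_norm ?pos// lerXn2r// nnegrE ltW// ?pos// ltW.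
Qed.

End test_function.

Lemma Rintegral_mulr_contraction (h : car R k.+1 -> R) s : tame h ->
  compact_support_in D h -> (forall z, `|h z| <= 1) -> 0 < s ->
  \int[mu]_(z in D) ((a \_ D) (xdil w s^-1 z) * h z) =
  \int[mu]_(z in D) (a z * (s ^+ k.+1 * h (xdil w s z))).
Proof.
move=> th supph h1 s0; have s_neq0 : s != 0 by rewrite gt_eqF.
pose F z := (a \_ D) (xdil w s^-1 z) * h z.
have intF : mu.-integrable setT (EFin \o F).
  apply: (integrable_mulr_bounded measurableT _ (tame_measurable th) (fun z _ => h1 z)).
  by apply: integrable_xdil; [rewrite invr_gt0|exact: integrable_patch].
have FE z : F (xdil w s z) = (a \_ D) z * h (xdil w s z) by rewrite /F xdilK.
transitivity (\int[mu]_z F z).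
  rewrite Rintegral_mkcond; apply: eq_Rintegral => z _; rewrite patchE.
  by case: ifPn => //; rewrite notin_setE /F => /(compact_support_out supph) ->; rewrite mulr0.
have -> : \int[mu]_z F z = s ^+ k.+1 * \int[mu]_z F (xdil w s z).
  by rewrite Rintegral_xdil// mulrA -exprMn mulfV// expr1n mul1r.
rewrite -RintegralZl//; last exact: integrable_xdil.
rewrite [RHS]Rintegral_mkcond; apply: eq_Rintegral => z _.
by rewrite FE !patchE; case: ifPn => _; [ring|rewrite mul0r mulr0].
Qed.

Lemma contraction_estimate s : has_cutoffs D -> 1 <= s ->
  (\int[mu]_(z in D) (`|a z - (a \_ D) (xdil w s^-1 z)|)%:E <=
   (s ^+ k * (s - 1) * (L * \int[mu]_(z in D) enorm (g z)))%:E)%E.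
Proof.
move=> cutD s1; have s0 : 0 < s by exact: lt_le_trans s1.
pose ac z := (a \_ D) (xdil w s^-1 z).
have intac : mu.-integrable D (EFin \o ac).
  apply: integrableS (_ : mu.-integrable setT _) => //.
  by apply: integrable_xdil; [rewrite invr_gt0|exact: integrable_patch].
have intB : mu.-integrable D (EFin \o (fun z => a z - ac z)).
  exact: (integrableB mD inta intac).
apply: (L1_norm_le_dual mD intB cutD) => h th supph h1.
rewrite (fineK_integral mD); last exact: integrable_mulr_tame.
under eq_Rintegral => z _ do rewrite mulrBl.
rewrite RintegralB//; [|exact: integrable_mulr_tame..].
by rewrite Rintegral_mulr_contraction// lee_fin dilation_pairing_le.
Qed.

End star_shaped_domain.

(** * Oscillation in space *)

Section cylinder.
Context {R : realType} (k : nat).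
Variables (alpha r t0 : R) (x0 : car R k).
Hypotheses (alpha0 : 0 < alpha) (r0 : 0 < r).
Let Q := pcyl alpha r t0 x0.
Let I := eball (t0 : car R 0) (alpha * r ^+ 2).
Let B := eball x0 r.
Let len0 : 0 < alpha * r ^+ 2. Proof. by rewrite mulr_gt0// exprn_gt0. Qed.
Let mI : measurable I := measurable_eball (t0 : car R 0) len0.
Let mB : measurable B := measurable_eball x0 r0.

Lemma measurable_pcyl : measurable Q.
Proof. by rewrite /Q pcylE; exact: (measurableX mI mB). Qed.

Lemma volQE : volQ alpha r t0 x0 = 2 * (alpha * r ^+ 2) * fine (leb R k B).
Proof.
by rewrite /volQ pcylE leb_setX// leb_eball0// -(fine_leb_eball x0 r0).
Qed.

Lemma volQ_gt0 : 0 < volQ alpha r t0 x0.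
Proof. by rewrite volQE !mulr_gt0// fine_leb_eball_gt0. Qed.

Lemma leb_pcyl : leb R k.+1 Q = (volQ alpha r t0 x0)%:E.
Proof.
rewrite volQE /Q pcylE leb_setX// leb_eball0// -(fine_leb_eball x0 r0).
by rewrite -EFinM.
Qed.

Lemma integral_pcyl (f : car R k.+1 -> \bar R) : measurable_fun setT f ->
  (forall z, 0 <= f z)%E ->
  (\int[leb R k.+1]_(z in Q) f z = \int[leb R 0]_(t in I) \int[leb R k]_(x in B) f (t, x))%E.
Proof. by rewrite /Q pcylE; exact: leb_tonelli_setX. Qed.

Lemma integral_pcyl_time (f : car R 0 -> R) : measurable_fun setT f -> (forall t, 0 <= f t) ->
  (\int[leb R k.+1]_(z in Q) (f (z.1 : R))%:E =
   (fine (leb R k B))%:E * \int[leb R 0]_(t in I) (f t)%:E)%E.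
Proof.
move=> mf f0; rewrite integral_pcyl; last 2 first.
- by apply/measurable_EFinP; exact: (measurableT_comp mf measurable_fst).
- by move=> z; rewrite lee_fin.
rewrite -ge0_integralZl//; last 2 first.
- by apply: measurable_funTS; exact/measurable_EFinP.
- by move=> t _; rewrite lee_fin.
apply: eq_integral => t _.
rewrite -[LHS]/(\int[leb R k]_(x in B) cst (f t)%:E x)%E.
by rewrite integral_cst// (fine_leb_eball x0 r0) muleC.
Qed.

Definition space_swap (p : car R k.+1 * car R k) : car R k.+1 * car R k :=
  (((p.1.1 : R), p.2) : car R k.+1, p.1.2).

Lemma measurable_space_swap : measurable_fun setT space_swap.
Proof.
apply/measurable_fun_pairP; split.
  apply/measurable_fun_pairP; split; last exact: measurable_snd.
  exact: (measurableT_comp measurable_fst measurable_fst).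
exact: (measurableT_comp measurable_snd measurable_fst).
Qed.

Lemma integral_space_swap (f : car R k.+1 * car R k -> \bar R) :
  measurable_fun setT f -> (forall p, 0 <= f p)%E ->
  (\int[leb R k.+1]_(z in Q) \int[leb R k]_(w in B) f (space_swap (z, w)) =
   \int[leb R k.+1]_(z in Q) \int[leb R k]_(w in B) f (z, w))%E.
Proof.
move=> mf f0.
have mfs := measurableT_comp mf measurable_space_swap.
have m_int (h : car R k.+1 * car R k -> \bar R) :
    measurable_fun setT h -> (forall p, 0 <= h p)%E ->
    measurable_fun setT (fun z => \int[leb R k]_(w in B) h (z, w))%E.
  by move=> mh h0; exact: (@measurable_leb_xsection R k.+1 k B h mB mh h0 setT).
rewrite (integral_pcyl (m_int _ mfs (fun p => f0 _))) => [|z]; last first.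
  by apply: integral_ge0 => w _; exact: f0.
rewrite (integral_pcyl (m_int _ mf f0)) => [|z]; last by apply: integral_ge0 => w _; exact: f0.
apply: eq_integral => t _ /=.
apply: (@leb_tonelli_exchange R k k B B (fun p => f (((t : R), p.2) : car R k.+1, p.1))) => //.
apply: (measurableT_comp mf); apply/measurable_fun_pairP; split; last exact: measurable_fst.
apply/measurable_fun_pairP; split; first exact: measurable_cst.
exact: measurable_snd.
Qed.

End cylinder.

Arguments space_swap {R k} p.
Arguments measurable_space_swap {R k}.

Section spatial_oscillation.
Context {R : realType} (k : nat).
Variables (alpha r t0 : R) (x0 : car R k).
Hypotheses (alpha0 : 0 < alpha) (r0 : 0 < r).
Let Q := pcyl alpha r t0 x0.
Let mu := leb R k.+1.
Let mQ : measurable Q := measurable_pcyl t0 x0 alpha0 r0.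
Let B := eball x0 r.
Let mB : measurable B := measurable_eball x0 r0.
Variables (a : car R k.+1 -> R) (g : car R k.+1 -> car R k).
Hypotheses (inta : mu.-integrable Q (EFin \o a)) (wg : weak_gradx Q a g).
Let G := \int[mu]_(z in Q) enorm (g z).

Lemma midpoint_estimate (w : car R k) : B w ->
  (\int[mu]_(z in Q) (`|a z - (a \_ Q) (xdil w 2^-1 z)|)%:E <= (2 ^+ k.+1 * r * G)%:E)%E.
Proof.
move=> wB; have starQ s z : 1 <= s -> Q (xdil w s z) -> Q z.
  by rewrite /Q pcylE => s1 [zI zB]; split => //; exact: eball_dil s1 wB zB.
have distQ z : Q z -> enorm (subv z.2 w) <= 2 * r.
  rewrite /Q pcylE => -[_ zB].
  rewrite (_ : subv z.2 w = subv (subv z.2 x0) (subv w x0)); last first.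
    by apply: dotv_ext => v; rewrite !dotvE; ring.
  by rewrite (le_trans (ler_enormB _ _))// mulrDl mul1r lerD// ltW.
have := contraction_estimate mQ (ebounded_pcyl _ _ _ _) starQ distQ inta wg
  (has_cutoffs_pcyl t0 x0 alpha0 r0) (ler1n R 2 : 1 <= 2).
by rewrite (_ : 2 ^+ k * (2 - 1) * (2 * r * G) = 2 ^+ k.+1 * r * G)// exprSr; ring.
Qed.

Let measurable_a : measurable_fun setT (a \_ Q) := measurable_patch mQ inta.

Let midpoint_osc (p : car R k.+1 * car R k) : \bar R :=
  (`|(a \_ Q) p.1 - (a \_ Q) (xdil p.2 2^-1 p.1)|)%:E.

Definition space_osc (p : car R k.+1 * car R k) : \bar R :=
  (`|(a \_ Q) p.1 - (a \_ Q) ((p.1.1 : R), p.2)|)%:E.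

Let measurable_midpoint_osc : measurable_fun setT midpoint_osc.
Proof.
apply/measurable_EFinP; apply: measurableT_comp => //; apply: measurable_funB.
  exact: (measurableT_comp measurable_a measurable_fst).
apply: (measurableT_comp measurable_a); apply: (@measurable_fun_dotv _ _ _ k.+1) => v.
rewrite (_ : (fun p => _) = fun p : car R k.+1 * car R k =>
    dotv p.1 ((v.1 : R), scalev 2^-1 v.2) + dotv p.2 (scalev 2^-1 v.2)); last first.
  by apply/funext => p /=; rewrite !dotvE; field.
apply: measurable_funD.
  exact: (measurableT_comp (@measurable_dotv R k.+1 _) measurable_fst).
exact: (measurableT_comp (measurable_dotv _) measurable_snd).
Qed.

Lemma measurable_space_osc : measurable_fun setT space_osc.
Proof.
apply/measurable_EFinP; apply: measurableT_comp => //; apply: measurable_funB.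
  exact: (measurableT_comp measurable_a measurable_fst).
apply: (measurableT_comp measurable_a); apply/measurable_fun_pairP; split.
  exact: (measurableT_comp measurable_fst measurable_fst).
exact: measurable_snd.
Qed.

Lemma space_osc_ge0 p : (0 <= space_osc p)%E. Proof. by rewrite lee_fin. Qed.

Let midpoint_osc_ge0 p : (0 <= midpoint_osc p)%E. Proof. by rewrite lee_fin. Qed.

(* The midpoint of [x] and [w] is symmetric. *)
Let space_osc_le p : (space_osc p <= midpoint_osc p + midpoint_osc (space_swap p))%E.
Proof.
rewrite -EFinD lee_fin; case: p => -[t x] w; rewrite /space_swap/=.
rewrite (_ : xdil x 2^-1 ((t, w) : car R k.+1) = xdil w 2^-1 ((t, x) : car R k.+1)); last first.
  by rewrite /xdil/= dil_half_sym.
rewrite -[X in `|X|](subrKA ((a \_ Q) (xdil w 2^-1 ((t, x) : car R k.+1)))).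
by rewrite (le_trans (ler_normD _ _))// lerD2l distrC.
Qed.

Let integral_midpoint_osc :
  (\int[mu]_(z in Q) \int[leb R k]_(w in B) midpoint_osc (z, w) <=
   (2 ^+ k.+1 * r * G)%:E * leb R k B)%E.
Proof.
rewrite (@leb_tonelli_exchange R k.+1 k Q B midpoint_osc)// -integral_cst//.
apply: ge0_le_integral => //.
- by move=> w _; apply: integral_ge0.
- have mswap : measurable_fun setT (fun p : car R k * car R k.+1 => midpoint_osc (p.2, p.1)).
    apply: (measurableT_comp measurable_midpoint_osc).
    by apply/measurable_fun_pairP; split; [exact: measurable_snd|exact: measurable_fst].
  exact: (@measurable_leb_xsection R k k.+1 Q _ mQ mswap (fun p => midpoint_osc_ge0 _) B).
move=> w wB; apply: le_trans (midpoint_estimate wB); rewrite le_eqVlt.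
by apply/predU1l/eq_integral => z zQ; rewrite /midpoint_osc/= [X in X - _]patchE zQ.
Qed.

Lemma space_oscillation_estimate :
  (\int[mu]_(z in Q) \int[leb R k]_(w in B) space_osc (z, w) <=
   (2 ^+ k.+2 * r * G)%:E * leb R k B)%E.
Proof.
have G0 : 0 <= G by apply: Rintegral_ge0 => z _; exact: enorm_ge0.
rewrite (_ : 2 ^+ k.+2 * r * G = 2 ^+ k.+1 * r * G + 2 ^+ k.+1 * r * G); last first.
  by rewrite [2 ^+ k.+2]exprS; ring.
rewrite EFinD ge0_muleDl ?lee_fin ?mulr_ge0 ?exprn_ge0 ?(ltW r0)//.
have swapE := integral_space_swap t0 x0 alpha0 r0 measurable_midpoint_osc midpoint_osc_ge0.
apply: le_trans (leeD integral_midpoint_osc integral_midpoint_osc).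
rewrite -[X in (_ <= _ + X)%E]swapE.
apply: (@iterated_integral_le_add R k.+1 k Q B midpoint_osc (midpoint_osc \o space_swap)
  space_osc mQ mB measurable_midpoint_osc _ measurable_space_osc midpoint_osc_ge0 _
  space_osc_ge0 space_osc_le) => [|p]; last exact: midpoint_osc_ge0.
exact: (measurableT_comp measurable_midpoint_osc measurable_space_swap).
Qed.

End spatial_oscillation.

(** * Weights and spatial means *)

Section bounded_support.
Context {R : realType} d (T : measurableType d) (mu : {measure set T -> \bar R}) (D : set T).
Hypotheses (mD : measurable D) (muD : (mu D < +oo)%E).

Lemma integrable_bounded_support (f : T -> R) (C : R) : measurable_fun setT f ->
  (forall x, `|f x| <= C) -> (forall x, ~ D x -> f x = 0) -> mu.-integrable setT (EFin \o f).
Proof.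
move=> mf fC f0; rewrite (_ : f = f \_ D).
  apply: integrable_patch => //; apply: measurable_bounded_integrable => //.
    exact: measurable_funTS.
  exists C; split => [|M CM x _ /=]; first exact: num_real.
  by rewrite (le_trans (fC x))// ltW.
by apply/funext => x; rewrite patchE; case: ifPn => //; rewrite notin_setE => /f0.
Qed.

Lemma integrable_indic : mu.-integrable setT (EFin \o (\1_D : T -> R)).
Proof.
apply: (@integrable_bounded_support _ 1); first exact: measurable_indic.
  by move=> x; rewrite indicE normr_nat; case: (x \in D).
by move=> x nDx; rewrite indicE memNset.
Qed.

End bounded_support.

Section ball_weight.
Context {R : realType}.
Implicit Types k : nat.

Record ball_weight k (x0 : car R k) (r c : R) (eta : car R k -> R) : Prop := BallWeight {
  weight_tame : tame eta;
  weight_support : compact_support_in (eball x0 r) eta;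
  weight_ge0 : forall x, 0 <= eta x;
  weight_le : forall x, eta x <= c / fine (leb R k (eball x0 r));
  weight_integral : \int[leb R k]_x eta x = 1;
  weight_gradient : exists2 p, is_gradient eta p &
    forall x, enorm (p x) <= c / fine (leb R k (eball x0 r)) / r
}.

Lemma integrable_weight k (x0 : car R k) (r c : R) (eta : car R k -> R) : 0 < r ->
  ball_weight x0 r c eta -> (leb R k).-integrable setT (EFin \o eta).
Proof.
move=> r0 wt.
apply: (integrable_bounded_support (measurable_eball x0 r0) (leb_eball_lty x0 r0)
  (tame_measurable (weight_tame wt))).
  by move=> x; rewrite ger0_norm ?(weight_ge0 wt)//; exact: (weight_le wt).
by move=> x; exact: compact_support_out (weight_support wt).
Qed.

Section ball_bump.
Variables (k : nat) (x0 : car R k) (r : R).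
Hypothesis r0 : 0 < r.
Let B := eball x0 r.
Let V := fine (leb R k B).
Let r_sq0 : 0 < r ^+ 2. Proof. by rewrite exprn_gt0. Qed.

Definition ball_bump (x : car R k) : R := expNV (1 - 2 / r ^+ 2 * sqdist x0 x).

Lemma tame_ball_bump : tame ball_bump.
Proof.
apply: tame_expNV; apply: tameB; first exact: tame_cst.
by apply: tameZ; exact: tame_sqdist.
Qed.

Lemma ball_bump_support : compact_support_in B ball_bump.
Proof.
apply: (compact_support_eball (m := r ^+ 2 / 2)) => // [|x rx]; first by have := r_sq0; lra.
by apply: expNV_eq0; rewrite subr_le0 mulrAC ler_pdivlMr//; lra.
Qed.

Lemma integrable_ball_bump : (leb R k).-integrable setT (EFin \o ball_bump).
Proof.
apply: (@integrable_bounded_support _ _ _ _ _ (measurable_eball x0 r0) (leb_eball_lty x0 r0) _ 1).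
- exact: tame_measurable tame_ball_bump.
- by move=> x; rewrite ger0_norm ?expNV_ge0 ?expNV_le1.
- by move=> x; exact: compact_support_out ball_bump_support.
Qed.

(* On the ball of radius [r / 2] the bump is at least [exp (-2)]. *)
Lemma integral_ball_bump_ge : expR (- 2) * 2^-1 ^+ k.+1 * V <= \int[leb R k]_x ball_bump x.
Proof.
have r_half0 : 0 < 2^-1 * r by rewrite mulr_gt0// invr_gt0.
have mB_half := measurable_eball x0 r_half0.
have int_indic := integrable_indic mB_half (leb_eball_lty x0 r_half0).
have -> : expR (- 2) * 2^-1 ^+ k.+1 * V =
    \int[leb R k]_x (expR (- 2) * \1_(eball x0 (2^-1 * r)) x).
  rewrite RintegralZl// -mulrA; congr (_ * _); rewrite /Rintegral integral_indic// setIT.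
  by rewrite leb_eball_scale ?invr_gt0// -(fine_leb_eball x0 r0).
apply: le_Rintegral => // [||x _].
- exact: (integrableZl measurableT _ int_indic).
- exact: integrable_ball_bump.
rewrite indicE; case: (boolP (x \in _)) => xB; last by rewrite mulr0 expNV_ge0.
rewrite mulr1 -[2]invrK; apply: expNV_ge; first by rewrite invr_gt0.
move: xB; rewrite inE eballE//= exprMn => xB.
rewrite lerBrDr -lerBrDl mulrAC ler_pdivrMr//; lra.
Qed.

Lemma ball_bump_gradient (C : R) : (forall y : R, y <= 1 -> `|dexpNV y| <= C) -> 0 <= C ->
  exists2 p, is_gradient ball_bump p & forall x, enorm (p x) <= 4 * C / r.
Proof.
move=> dC C0; pose arg x := 1 - 2 / r ^+ 2 * sqdist x0 x.
have arg_grad : is_gradient arg (fun x => scalev (- (4 / r ^+ 2)) (subv x x0)).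
  move=> z v; have ds := is_gradient_sqdist x0 z v.
  have := is_deriveB (is_derive_cst (1 : R) (0 : R) (1 : R)) (is_deriveZ (2 / r ^+ 2) ds).
  move=> darg; apply: (is_derive_eq darg); rewrite sub0r /GRing.scale/= !dotvZl; ring.
exists (fun x => scalev (dexpNV (arg x)) (scalev (- (4 / r ^+ 2)) (subv x x0))).
  exact: is_gradient_comp is_derive_expNV arg_grad.
move=> x; rewrite !enormZ normrN [`|4 / r ^+ 2|]ger0_norm ?divr_ge0 ?(ltW r_sq0)//.
have [xB|nxB] := ltP (enorm (subv x x0)) r; last first.
  rewrite dexpNV_eq0 ?normr0 ?mul0r ?divr_ge0 ?mulr_ge0 ?(ltW r0)//.
  have rx : r ^+ 2 <= sqdist x0 x by rewrite leNgt -enorm_lt// -leNgt.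
  by rewrite subr_le0 mulrAC ler_pdivlMr//; have := r_sq0; lra.
rewrite (_ : 4 * C / r = C * (4 / r ^+ 2 * r)); last by field; rewrite gt_eqF.
apply: ler_pM => //; first by rewrite mulr_ge0 ?enorm_ge0 ?divr_ge0 ?(ltW r_sq0).
  by apply: dC; rewrite gerBl mulr_ge0 ?sqdist_ge0 ?divr_ge0 ?(ltW r_sq0).
by rewrite ler_wpM2l ?divr_ge0 ?(ltW r_sq0)// ltW.
Qed.

End ball_bump.

Lemma ball_weight_exists k : exists2 c : R, 0 < c &
  forall (x0 : car R k) r, 0 < r -> exists eta, ball_weight x0 r c eta.
Proof.
have [C C0 dC] := @dexpNV_bounded R.
pose c1 : R := expR 2 * 2 ^+ k.+1.
have c10 : 0 < c1 by rewrite mulr_gt0 ?expR_gt0 ?exprn_gt0.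
exists (c1 * (1 + 4 * C)); first by rewrite mulr_gt0// addr_gt0// mulr_gt0.
move=> x0 r r0; set V := fine (leb R k (eball x0 r)).
have V0 : 0 < V by exact: fine_leb_eball_gt0.
pose N := \int[leb R k]_x ball_bump x0 r x.
have N_ge : c1^-1 * V <= N.
  have := integral_ball_bump_ge x0 r0; rewrite expRN exprVn -invfM.
  exact.
have N0 : 0 < N by apply: lt_le_trans N_ge; rewrite mulr_gt0// invr_gt0.
have NV_ge0 : 0 <= N^-1 by rewrite invr_ge0 ltW.
have NV_le : N^-1 <= c1 / V.
  by rewrite -[leRHS]invrK lef_pV2 ?posrE ?invr_gt0 ?divr_gt0// invf_div mulrC.
have C4 : 0 <= 4 * C by rewrite mulr_ge0// ltW.
have NV_le_c : N^-1 <= c1 * (1 + 4 * C) / V.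
  by rewrite (le_trans NV_le)// ler_wpM2r ?invr_ge0 ?(ltW V0)// ler_peMr ?(ltW c10)// lerDl.
exists (fun x => N^-1 * ball_bump x0 r x); split.
- by apply: tameZ; exact: tame_ball_bump.
- by apply: compact_supportM; exact: ball_bump_support.
- by move=> x; rewrite mulr_ge0// expNV_ge0.
- by move=> x; rewrite (le_trans _ NV_le_c)// ler_piMr// expNV_le1.
- by rewrite RintegralZl//; [rewrite mulVf// gt_eqF|exact: integrable_ball_bump].
have [p pgrad p_le] := ball_bump_gradient x0 r0 dC (ltW C0).
exists (fun x => scalev N^-1 (p x)); first exact: is_gradientZ.
move=> x; rewrite enormZ ger0_norm// -/V.
apply: le_trans (ler_pM NV_ge0 (enorm_ge0 _) NV_le (p_le x)) _.
rewrite [leLHS]mulrA ler_wpM2r ?invr_ge0 ?(ltW r0)// mulrAC ler_wpM2r ?invr_ge0 ?(ltW V0)//.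
by rewrite ler_wpM2l ?(ltW c10)// lerDr.
Qed.

End ball_weight.

Section space_mean.
Context {R : realType} (k : nat).
Variables (alpha r t0 : R) (x0 : car R k).
Hypotheses (alpha0 : 0 < alpha) (r0 : 0 < r).
Let Q := pcyl alpha r t0 x0.
Let mu := leb R k.+1.
Let mQ : measurable Q := measurable_pcyl t0 x0 alpha0 r0.
Let I := eball (t0 : car R 0) (alpha * r ^+ 2).
Let B := eball x0 r.
Let V := fine (leb R k B).
Variables (a : car R k.+1 -> R) (c : R) (eta : car R k -> R).
Hypotheses (inta : mu.-integrable Q (EFin \o a)) (weta : ball_weight x0 r c eta).

Definition space_mean (t : car R 0) : R := \int[leb R k]_w ((a \_ Q) ((t : R), w) * eta w).

Let teta : tame eta := weight_tame weta.

Let cV0 : 0 <= c / V.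
Proof. exact: le_trans (weight_ge0 weta x0) (weight_le weta x0). Qed.

Let normr_eta_le x : `|eta x| <= c / V.
Proof. by rewrite ger0_norm ?(weight_ge0 weta)//; exact: (weight_le weta). Qed.

Let int_patch_weight : mu.-integrable setT (EFin \o (fun z => (a \_ Q) z * eta z.2)).
Proof.
apply: (integrable_mulr_bounded (C := c / V) measurableT) => [||z _].
- exact: integrable_patch.
- exact: tame_measurable (tame_snd teta).
- exact: normr_eta_le.
Qed.

Lemma integrable_space_mean : (leb R 0).-integrable setT (EFin \o space_mean).
Proof.
have intA := leb_fubini_integrable int_patch_weight.
have mA := measurable_int _ intA.
apply: le_integrable intA => //.
  by apply/measurable_EFinP; exact: (measurableT_comp _ mA).
move=> t _; rewrite /= /space_mean /Rintegral.
by case: (integral _ _ _) => [s| |] //=; rewrite leey.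
Qed.

Lemma measurable_space_mean : measurable_fun setT space_mean.
Proof. exact: integrable_measurable_fun integrable_space_mean. Qed.

Lemma space_mean_pairing (psi : car R 0 -> R) : tame psi ->
  \int[leb R 0]_(t in I) (space_mean t * psi t) =
  \int[mu]_(z in Q) (a z * (psi (z.1 : R) * eta z.2)).
Proof.
move=> tpsi.
have tpsi_eta : tame (fun z : car R k.+1 => psi (z.1 : R) * eta z.2).
  by apply: tameM; [exact: (tame_fst k tpsi)|exact: tame_snd].
have int_pairing := integrable_mulr_tame mQ (ebounded_pcyl _ _ _ _) inta tpsi_eta.
pose F z := (a \_ Q) z * (psi (z.1 : R) * eta z.2).
have FE : (fun z => a z * (psi (z.1 : R) * eta z.2)) \_ Q = F.
  by apply/funext => z; rewrite /F !patchE; case: ifPn => // _; rewrite mul0r.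
have intF : mu.-integrable setT (EFin \o F) by rewrite -FE; exact: integrable_patch.
rewrite [RHS]Rintegral_mkcond FE.
transitivity (\int[leb R 0]_t (space_mean t * psi t)).
  rewrite Rintegral_mkcond; apply: eq_Rintegral => t _; rewrite patchE; case: ifPn => //.
  rewrite notin_setE => nIt; rewrite /space_mean /Rintegral integral0_eq ?mul0r// => w _.
  by rewrite patchE memNset ?mul0r// /Q pcylE => -[].
rewrite /Rintegral (leb_fubini intF); congr fine; apply: ae_eq_integral => //.
- apply/measurable_EFinP; apply: measurable_funM; first exact: measurable_space_mean.
  exact: tame_measurable.
- exact: (measurable_int _ (leb_fubini_integrable intF)).
have := leb_fubini_ae int_patch_weight; apply: filterS => t int_t _.
have -> : (\int[leb R k]_w (F ((t : R), w))%:E =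
    \int[leb R k]_w ((psi t)%:E * ((a \_ Q) ((t : R), w) * eta w)%:E))%E.
  by apply: eq_integral => w _; rewrite -EFinM; congr EFin; rewrite /F/=; ring.
rewrite integralZl// (fineK_integral measurableT)//.
by rewrite EFinM muleC.
Qed.

Variable g : car R k.+1 -> car R k.
Hypothesis wg : weak_gradx Q a g.

Let mB : measurable B := measurable_eball x0 r0.

Let measurable_a : measurable_fun setT (a \_ Q) := measurable_patch mQ inta.

Let osc := space_osc alpha r t0 x0 a.

Let m_osc : measurable_fun setT osc := measurable_space_osc alpha0 r0 inta.

Let weighted_diff z w : R := (a z - (a \_ Q) ((z.1 : R), w)) * eta w.

Let measurable_weighted_diff z : measurable_fun setT (weighted_diff z).
Proof.
apply: measurable_funM; last exact: tame_measurable.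
apply: measurable_funB; first exact: measurable_cst.
exact: (measurableT_comp measurable_a (pair1_measurable (z.1 : R))).
Qed.

Let integral_weighted_diff_le z : Q z ->
  (\int[leb R k]_w (`|weighted_diff z w|)%:E <= (c / V)%:E * \int[leb R k]_(w in B) osc (z, w))%E.
Proof.
move=> Qz; have oscE w : osc (z, w) = (`|a z - (a \_ Q) ((z.1 : R), w)|)%:E.
  by rewrite /osc/space_osc/= [X in X - _]patchE mem_set.
have m_osc_z : measurable_fun setT (fun w => osc (z, w)).
  exact: (measurableT_comp m_osc (pair1_measurable z)).
rewrite -ge0_integralZl//; last 2 first.
- exact: measurable_funTS m_osc_z.
- by move=> w _; exact: space_osc_ge0.
rewrite [leRHS]integral_mkcond; apply: ge0_le_integral => //.
- by apply/measurable_EFinP; exact: measurableT_comp.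
- exact/(measurable_restrictT _ mB)/measurable_funTS/measurable_funeM.
move=> w _; rewrite patchE; case: ifPn => [wB|].
  by rewrite oscE -EFinM lee_fin normrM mulrC ler_wpM2r.
rewrite notin_setE => nBw.
by rewrite /weighted_diff (compact_support_out (weight_support weta) nBw) mulr0 normr0.
Qed.

Lemma space_mean_pointwise z : Q z ->
  ((`|a z - space_mean (z.1 : R)|)%:E <= (c / V)%:E * \int[leb R k]_(w in B) osc (z, w))%E.
Proof.
move=> Qz; apply: le_trans (integral_weighted_diff_le Qz); set f := weighted_diff z.
have mf : measurable_fun setT f := measurable_weighted_diff z.
have [f_fin|] := ltP (\int[leb R k]_w (`|f w|)%:E)%E +oo%E; last first.
  by apply: le_trans; exact: leey.
have intf : (leb R k).-integrable setT (EFin \o f).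
  by apply/integrableP; split => //; exact/measurable_EFinP.
have int_eta := integrable_weight r0 weta.
have int_aeta : (leb R k).-integrable setT (EFin \o (fun w => a z * eta w)).
  exact: (integrableZl measurableT (a z) int_eta).
have -> : a z - space_mean (z.1 : R) = \int[leb R k]_w f w.
  have -> : space_mean (z.1 : R) = \int[leb R k]_w (a z * eta w - f w).
    by apply: eq_Rintegral => w _; rewrite /f /weighted_diff; ring.
  by rewrite RintegralB// RintegralZl// (weight_integral weta) mulr1 subKr.
by rewrite EFin_normr_Rintegral//; apply: le_abse_integral => //; exact/measurable_EFinP.
Qed.

Lemma space_mean_close :
  (\int[mu]_(z in Q) (`|a z - space_mean (z.1 : R)|)%:E <=
   (c * 2 ^+ k.+2 * r * \int[mu]_(z in Q) enorm (g z))%:E)%E.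
Proof.
have m_int := @measurable_leb_xsection R k.+1 k B osc mB m_osc (space_osc_ge0 _ _ _ _ _) Q.
apply: (@le_trans _ _ (\int[mu]_(z in Q) ((c / V)%:E * \int[leb R k]_(w in B) osc (z, w)))%E).
  apply: ge0_le_integral => //.
  - apply/measurable_EFinP/measurableT_comp => //; apply: measurable_funB.
      exact: integrable_measurable_fun inta.
    apply: measurable_funTS; exact: (measurableT_comp measurable_space_mean measurable_fst).
  - exact: measurable_funeM.
  - by move=> z Qz; exact: space_mean_pointwise.
rewrite ge0_integralZl//; last by move=> z _; apply: integral_ge0 => w _; exact: space_osc_ge0.
have osc_le := space_oscillation_estimate alpha0 r0 inta wg.
apply: le_trans (lee_wpmul2l _ osc_le) _; first by rewrite lee_fin.
rewrite -(fine_leb_eball x0 r0) -!EFinM lee_fin -/V le_eqVlt; apply: predU1l.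
by field; rewrite gt_eqF// fine_leb_eball_gt0.
Qed.

End space_mean.

(** * The time derivative *)

Section one_variable.
Context {R : realType}.

Lemma is_gradient_derive (F F' : R -> R) : (forall t, is_derive t (1 : R) F (F' t)) ->
  is_gradient (F : car R 0 -> R) (F' : car R 0 -> car R 0).
Proof.
move=> dF; have := is_gradient_comp dF (is_gradient_dotv ((1 : R) : car R 0)).
by congr is_gradient; apply/funext => t; rewrite /= !mulr1.
Qed.

Lemma tame_is_derive (f : car R 0 -> R) (t : R) : tame f ->
  is_derive t (1 : R) (f : R -> R) (dirder f (t : car R 0) (1 : R)).
Proof.
move=> tf; apply: is_derive_translate.
have := is_derive_dirder (t : car R 0) ((1 : R) : car R 0) tf.
by congr is_derive; apply/funext => s /=; rewrite mulr1.
Qed.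

Lemma tame_continuous (f : car R 0 -> R) : tame f -> continuous (f : R -> R).
Proof.
move=> tf t; apply: differentiable_continuous; apply/derivable1_diffP.
by have [] := tame_is_derive t tf.
Qed.

Lemma tame_antiderivative (F : R -> R) (f : car R 0 -> R) : tame f ->
  (forall t : R, is_derive t (1 : R) F (f t)) -> tame (F : car R 0 -> R).
Proof.
move=> tf dF; pose F_ n := if n is m.+1 then iterD (nseq m ((1 : R) : car R 0)) f else F.
have dF_ : deriv_seq F_.
  case=> [//|n] t; apply: tame_is_derive.
  by elim: n => [//|n IH] /=; exact: tame_dirder.
have := tame_comp dF_ (tame_dotv ((1 : R) : car R 0)).
by congr tame; apply/funext => t; rewrite /= mulr1.
Qed.

Definition primitive (f : R -> R) (t : R) : R := \int[lebesgue_measure]_(s in `]-oo, t]) f s.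

Lemma is_derive_primitive (f : R -> R) (t : R) : continuous f ->
  lebesgue_measure.-integrable setT (EFin \o f) -> is_derive t (1 : R) (primitive f) (f t).
Proof.
move=> cf intf; have lt_t1 : t < t + 1 by rewrite ltrDl.
have intf_t1 : lebesgue_measure.-integrable [set` Interval -oo%O (BRight (t + 1))] (EFin \o f).
  by apply: integrableS intf.
have [dF eF] := @continuous_FTC1 R f -oo%O t (t + 1) lt_t1 intf_t1 (ltNyr _) (cf t).
by apply: (DeriveDef dF); rewrite -derive1E.
Qed.

Lemma normr_primitive_le (f : R -> R) (t : R) : lebesgue_measure.-integrable setT (EFin \o f) ->
  `|primitive f t| <= \int[lebesgue_measure]_s `|f s|.
Proof.
move=> intf.
have mt : measurable (`]-oo, t]%classic : set (measurableTypeR R)) by exact: measurable_itv.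
have intf_t : lebesgue_measure.-integrable `]-oo, t] (EFin \o f) by apply: integrableS intf.
apply: (@le_trans _ _ (\int[lebesgue_measure]_(s in `]-oo, t]) `|f s|)).
  exact: le_normr_Rintegral.
rewrite Rintegral_mkcond; apply: le_Rintegral => //.
- apply: (@integrable_patch _ _ (measurableTypeR R) _ _ mt (fun s => `|f s|)).
  exact: integrable_abse intf_t.
- exact: integrable_abse intf.
- by move=> s _; rewrite patchE; case: ifPn => // _; exact: normr_ge0.
Qed.

Lemma primitive_eq0 (f : R -> R) (t0 m t : R) : (forall s, m < (s - t0) ^+ 2 -> f s = 0) ->
  \int[lebesgue_measure]_s f s = 0 -> m < (t - t0) ^+ 2 -> primitive f t = 0.
Proof.
move=> f0 intf0 mt; have [tt0|tt0] := leP t t0.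
  rewrite /primitive /Rintegral integral0_eq// => s; rewrite /= in_itv/= => st.
  by rewrite f0//; apply: lt_le_trans mt _; nra.
rewrite -[RHS]intf0 /primitive Rintegral_mkcond; apply: eq_Rintegral => s _.
rewrite patchE; case: ifPn => //; rewrite notin_setE/= in_itv/= => /negP; rewrite -ltNge => ts.
by rewrite f0//; apply: lt_le_trans mt _; nra.
Qed.

End one_variable.

Section time_interval.
Context {R : realType} (t0 s : R).
Hypothesis s0 : 0 < s.
Let I := eball (t0 : car R 0) s.
Let mI : measurable I := measurable_eball (t0 : car R 0) s0.
Let I_lty : (leb R 0 I < +oo)%E := leb_eball_lty (t0 : car R 0) s0.

Lemma integrable_test (f : car R 0 -> R) (K : R) : tame f -> compact_support_in I f ->
  (forall t, `|f t| <= K) -> (leb R 0).-integrable setT (EFin \o f).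
Proof.
move=> tf suppf fK; apply: (integrable_bounded_support mI I_lty (tame_measurable tf) fK) => t.
exact: compact_support_out.
Qed.

Lemma Rintegral_normr_test_le (f : car R 0 -> R) (K : R) : tame f -> compact_support_in I f ->
  (forall t, `|f t| <= K) -> \int[leb R 0]_t `|f t| <= 2 * s * K.
Proof.
move=> tf suppf fK; have int_indic := integrable_indic mI I_lty.
have -> : 2 * s * K = \int[leb R 0]_t (K * \1_I t).
  rewrite RintegralZl// /Rintegral integral_indic// setIT leb_eball0//=; ring.
apply: le_Rintegral => //.
- exact: integrable_abse (integrable_test tf suppf fK).
- exact: (integrableZl measurableT K int_indic).
move=> t _; rewrite indicE; case: (boolP (t \in I)) => [_|]; first by rewrite mulr1.
by rewrite notin_setE => nIt; rewrite (compact_support_out suppf nIt) normr0 mulr0.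
Qed.

Lemma test_antiderivative (psi : car R 0 -> R) (K : R) :
  tame psi -> compact_support_in I psi -> (forall t, `|psi t| <= K) ->
  \int[leb R 0]_t psi t = 0 ->
  exists phi : car R 0 -> R, [/\ tame phi, compact_support_in I phi, is_gradient phi psi &
    forall t, `|phi t| <= 2 * s * K].
Proof.
move=> tpsi suppsi psiK intpsi0; have intpsi := integrable_test tpsi suppsi psiK.
have dphi t : is_derive (t : R) (1 : R) (primitive psi) (psi t).
  by apply: is_derive_primitive; [exact: tame_continuous|exact: intpsi].
exists (primitive psi); split.
- exact: tame_antiderivative dphi.
- have [m ms psi0] := compact_support_eball0 s0 suppsi.
  apply: (compact_support_eball s0 ms) => t; rewrite sqdist0E.
  exact: primitive_eq0.
- exact: is_gradient_derive.
- move=> t; apply: le_trans (normr_primitive_le _ intpsi) _.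
  exact: Rintegral_normr_test_le.
Qed.

Variables (c : R) (theta : car R 0 -> R).
Hypothesis wtheta : ball_weight (t0 : car R 0) s c theta.

Definition zero_mean_part (h : car R 0 -> R) (t : car R 0) : R :=
  h t - (\int[leb R 0]_u h u) * theta t.

Section zero_mean_part.
Variable h : car R 0 -> R.
Hypotheses (th : tame h) (supph : compact_support_in I h) (h1 : forall t, `|h t| <= 1).

Lemma tame_zero_mean_part : tame (zero_mean_part h).
Proof. by apply: tameB => //; apply: tameZ; exact: weight_tame wtheta. Qed.

Lemma zero_mean_part_support : compact_support_in I (zero_mean_part h).
Proof.
rewrite /zero_mean_part; under eq_fun do rewrite -mulNr.
by apply: compact_supportD => //; apply: compact_supportM; exact: weight_support wtheta.
Qed.

Lemma normr_zero_mean_part_le t : `|zero_mean_part h t| <= 1 + c.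
Proof.
have inth := integrable_test th supph h1.
apply: le_trans (ler_normB _ _) _; rewrite lerD// normrM.
rewrite [`|theta t|]ger0_norm ?(weight_ge0 wtheta)//.
have mean_le : `|\int[leb R 0]_u h u| <= 2 * s.
  apply: le_trans (le_normr_Rintegral measurableT inth) _.
  by rewrite -[leRHS]mulr1 Rintegral_normr_test_le.
apply: le_trans (ler_pM _ (weight_ge0 wtheta t) mean_le (weight_le wtheta t)) _ => //.
by rewrite leb_eball0//= mulrCA mulfV ?mulr1// gt_eqF// mulr_gt0.
Qed.

Lemma Rintegral_zero_mean_part : \int[leb R 0]_t zero_mean_part h t = 0.
Proof.
have inth := integrable_test th supph h1; have inttheta := integrable_weight s0 wtheta.
rewrite RintegralB//; last exact: (integrableZl measurableT _ inttheta).
by rewrite RintegralZl// (weight_integral wtheta) mulr1 subrr.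
Qed.

Lemma Rintegral_mulr_zero_mean_part (f : car R 0 -> R) :
  (leb R 0).-integrable I (EFin \o f) ->
  \int[leb R 0]_(t in I) ((f t - \int[leb R 0]_(t in I) (f t * theta t)) * h t) =
  \int[leb R 0]_(t in I) (f t * zero_mean_part h t).
Proof.
move=> intf; pose C := \int[leb R 0]_(t in I) (f t * theta t); pose m := \int[leb R 0]_u h u.
have bI := ebounded_eball (t0 : car R 0) s.
have inth : (leb R 0).-integrable I (EFin \o h).
  by apply: integrableS (integrable_test th supph h1).
have int_fh := integrable_mulr_tame mI bI intf th.
have int_ftheta := integrable_mulr_tame mI bI intf (weight_tame wtheta).
rewrite -/C; transitivity (\int[leb R 0]_(t in I) (f t * h t) - m * C).
  have -> : m * C = \int[leb R 0]_(t in I) (C * h t).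
    rewrite RintegralZl// mulrC /m [in RHS]Rintegral_mkcond; congr (_ * _).
    apply: eq_Rintegral => t _; rewrite patchE; case: ifPn => //.
    by rewrite notin_setE; exact: compact_support_out.
  rewrite -RintegralB//; last exact: (integrableZl mI C inth).
  by apply: eq_Rintegral => t _; rewrite mulrBl.
rewrite -RintegralZl// -RintegralB//; last exact: (integrableZl mI m int_ftheta).
by apply: eq_Rintegral => t _; rewrite /zero_mean_part -/m; ring.
Qed.

End zero_mean_part.

End time_interval.

Section gradients.
Context {R : realType} (k : nat).

Lemma is_gradient_fst (f : car R 0 -> R) (p : car R 0 -> car R 0) : is_gradient f p ->
  is_gradient (fun z : car R k.+1 => f (z.1 : R)) (fun z => ((p (z.1 : R) : R), zerov R k)).
Proof.
move=> fp z v; have := fp (z.1 : R) (v.1 : R).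
by rewrite /= dotv0l addr0.
Qed.

Lemma is_gradient_snd (f : car R k -> R) p : is_gradient f p ->
  is_gradient (fun z : car R k.+1 => f z.2) (fun z => ((0 : R), p z.2)).
Proof. by move=> fp z v; have := fp z.2 v.2; rewrite /= mul0r add0r. Qed.

Lemma gradx_gradient (f : car R k.+1 -> R) p z : is_gradient f p -> gradx f z = (p z).2.
Proof.
move=> fp; rewrite /gradx -[RHS]gradof_dotv; congr gradof; apply/funext => v.
by rewrite (is_gradient_dirder fp) /= mulr0 add0r.
Qed.

Lemma dt_gradient (f : car R k.+1 -> R) p z : is_gradient f p -> dt f z = (p z).1.
Proof. by move=> fp; rewrite /dt (is_gradient_dirder fp) /= mulr1 dotv0r addr0. Qed.

Lemma supn_le j (f : car R j -> R) C : (forall z, `|f z| <= C) -> (supn f <= C%:E)%E.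
Proof. by move=> fC; apply: ge_ereal_sup => _ [z _ <-]; rewrite lee_fin. Qed.

End gradients.

Lemma NQ_dt_ge (R : realType) k (alpha r t0 : R) (x0 : car R k) (a xi : car R k.+1 -> R) :
  FQ alpha r t0 x0 xi ->
  ((r / volQ alpha r t0 x0)%:E *
    `| - (\int[leb R k.+1]_(z in pcyl alpha r t0 x0) (a z * dt xi z)%:E) |
   <= NQ_dt alpha r t0 x0 a)%E.
Proof. by move=> xiF; apply: ereal_sup_ubound; exists xi. Qed.

Section time_estimate.
Context {R : realType} (k : nat).
Variables (alpha r t0 : R) (x0 : car R k).
Hypotheses (alpha0 : 0 < alpha) (r0 : 0 < r).
Let Q := pcyl alpha r t0 x0.
Let mu := leb R k.+1.
Let mQ : measurable Q := measurable_pcyl t0 x0 alpha0 r0.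
Let len := alpha * r ^+ 2.
Let len0 : 0 < len. Proof. by rewrite mulr_gt0// exprn_gt0. Qed.
Let I := eball (t0 : car R 0) len.
Let mI : measurable I := measurable_eball (t0 : car R 0) len0.
Let V := fine (leb R k (eball x0 r)).
Let V0 : 0 < V := fine_leb_eball_gt0 x0 r0.
Let vol := volQ alpha r t0 x0.
Let vol0 : 0 < vol := volQ_gt0 t0 x0 alpha0 r0.
Variables (c : R) (eta : car R k -> R).
Hypotheses (c0 : 0 < c) (weta : ball_weight x0 r c eta).

Section tensor_test_function.
Variables (phi psi : car R 0 -> R) (K : R).
Hypotheses (K0 : 0 < K) (tphi : tame phi) (suppphi : compact_support_in I phi).
Hypotheses (dphi : is_gradient phi psi) (phi_le : forall t, `|phi t| <= 2 * len * K).
Hypothesis psi_le : forall t, `|psi t| <= K.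

(* The sum of the three sup norms of [phi(t) eta(x)] weighted as in [FQ] is at most
   [2 len K c / V + r (2 len K c / (V r)) + len (K c / V)]. *)
Let kappa := 5 * len * K * c / V.
Let kappa0 : 0 < kappa. Proof. by rewrite divr_gt0// !mulr_gt0. Qed.
Let kappaV0 : 0 <= kappa^-1. Proof. by rewrite invr_ge0 ltW. Qed.

Definition tensor_test (z : car R k.+1) : R := kappa^-1 * (phi (z.1 : R) * eta z.2).

Let eta_le x : `|eta x| <= c / V.
Proof. by rewrite ger0_norm ?(weight_ge0 weta)//; exact: weight_le weta x. Qed.

Let tensor_test_gradient p : is_gradient eta p -> is_gradient tensor_test
  (fun z => scalev kappa^-1 (addv (scalev (phi (z.1 : R)) (((0 : R), p z.2) : car R k.+1))
    (scalev (eta z.2) (((psi (z.1 : R) : R), zerov R k) : car R k.+1)))).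
Proof.
move=> dp; apply: is_gradientZ; apply: is_gradientM; last exact: is_gradient_snd.
exact: (is_gradient_fst dphi).
Qed.

Lemma dt_tensor_test z : dt tensor_test z = kappa^-1 * (psi (z.1 : R) * eta z.2).
Proof.
have [p dp _] := weight_gradient weta.
by rewrite (dt_gradient z (tensor_test_gradient dp)) /= mulr0 add0r [psi _ * _]mulrC.
Qed.

Let supn_tensor_test : (supn tensor_test <= (kappa^-1 * (2 * len * K * (c / V)))%:E)%E.
Proof.
apply: supn_le => z; rewrite normrM [`|kappa^-1|]ger0_norm// ler_wpM2l// normrM.
exact: ler_pM.
Qed.

Let supn_gradx_tensor_test : (supn (fun z => enorm (gradx tensor_test z)) <=
  (kappa^-1 * (2 * len * K * (c / V / r)))%:E)%E.
Proof.
have [p dp p_le] := weight_gradient weta.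
apply: supn_le => z; rewrite ger0_norm ?enorm_ge0//.
rewrite (gradx_gradient z (tensor_test_gradient dp)) /=.
rewrite enormZ [`|kappa^-1|]ger0_norm// ler_wpM2l// scalev0 addv0 enormZ.
by apply: ler_pM; rewrite ?enorm_ge0.
Qed.

Let supn_dt_tensor_test : (supn (dt tensor_test) <= (kappa^-1 * (K * (c / V)))%:E)%E.
Proof.
apply: supn_le => z; rewrite dt_tensor_test normrM [`|kappa^-1|]ger0_norm// ler_wpM2l// normrM.
exact: ler_pM.
Qed.

Lemma FQ_tensor_test : FQ alpha r t0 x0 tensor_test.
Proof.
split.
  split.
    apply/tame_smooth/tameZ; apply: tameM; first exact: (tame_fst k tphi).
    exact: (tame_snd (weight_tame weta)).
  apply: compact_supportM; rewrite pcylE.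
  exact: compact_support_setX suppphi (weight_support weta).
apply: le_trans (leeD (leeD supn_tensor_test (lee_wpmul2l _ supn_gradx_tensor_test))
  (lee_wpmul2l _ supn_dt_tensor_test)) _.
- by rewrite lee_fin ltW.
- by rewrite lee_fin ltW.
rewrite -!EFinM -!EFinD lee_fin -/len le_eqVlt; apply: predU1l.
by rewrite /kappa; field; rewrite !gt_eqF.
Qed.

Lemma tensor_pairing_le (a : car R k.+1 -> R) : tame psi -> mu.-integrable Q (EFin \o a) ->
  (`|\int[mu]_(z in Q) (a z * (psi (z.1 : R) * eta z.2))|%:E <=
   (5 * alpha * r * K * c * vol / V)%:E * NQ_dt alpha r t0 x0 a)%E.
Proof.
move=> tpsi inta; set J := \int[mu]_(z in Q) _.
have int_pairing : mu.-integrable Q (EFin \o (fun z => a z * (psi (z.1 : R) * eta z.2))).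
  apply: (integrable_mulr_tame mQ (ebounded_pcyl _ _ _ _) inta).
  by apply: tameM; [exact: (tame_fst k tpsi)|exact: (tame_snd (weight_tame weta))].
have dt_pairing : (\int[mu]_(z in Q) (a z * dt tensor_test z)%:E = (kappa^-1 * J)%:E)%E.
  under eq_integral => z _ do rewrite dt_tensor_test mulrCA EFinM.
  by rewrite integralZl// (fineK_integral mQ).
have := NQ_dt_ge a FQ_tensor_test.
rewrite dt_pairing -EFinN abse_EFin -EFinM normrN normrM [`|kappa^-1|]ger0_norm// => J_le.
rewrite (_ : `|J| = 5 * alpha * r * K * c * vol / V * (r / vol * (kappa^-1 * `|J|))).
  by rewrite EFinM lee_wpmul2l// lee_fin divr_ge0 ?(ltW V0)// ltW// !mulr_gt0.
by rewrite /kappa /len; field; rewrite !gt_eqF.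
Qed.

End tensor_test_function.

Variables (a : car R k.+1 -> R) (c' : R) (theta : car R 0 -> R).
Hypothesis inta : mu.-integrable Q (EFin \o a).
Hypotheses (c'0 : 0 < c') (wtheta : ball_weight (t0 : car R 0) len c' theta).
Let A := space_mean alpha r t0 x0 a eta.

Lemma time_estimate :
  (\int[leb R 0]_(t in I) (`|A t - \int[leb R 0]_(t in I) (A t * theta t)|)%:E <=
   (5 * alpha * r * (1 + c') * c * vol / V)%:E * NQ_dt alpha r t0 x0 a)%E.
Proof.
have intA : (leb R 0).-integrable I (EFin \o A).
  by apply: integrableS (integrable_space_mean alpha0 r0 inta weta).
pose C := \int[leb R 0]_(t in I) (A t * theta t); rewrite -/C.
have intC : (leb R 0).-integrable I (EFin \o cst C).
  apply: measurable_bounded_integrable => //; first exact: leb_eball_lty.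
  exact: bounded_cst.
have intAC : (leb R 0).-integrable I (EFin \o (fun t => A t - C)).
  exact: (integrableB mI intA intC).
apply: (L1_norm_le_dual mI intAC); first exact: has_cutoffs_eball.
move=> h th supph h1; pose psi := zero_mean_part theta h.
have tpsi : tame psi := tame_zero_mean_part wtheta th.
have psi_le t : `|psi t| <= 1 + c' := normr_zero_mean_part_le len0 wtheta th supph h1 t.
have [phi [tphi suppphi dphi phi_le]] := test_antiderivative len0 tpsi
  (zero_mean_part_support wtheta supph) psi_le (Rintegral_zero_mean_part len0 wtheta th supph h1).
rewrite (fineK_integral mI); last first.
  by apply: integrable_mulr_tame => //; exact: ebounded_eball.
rewrite (Rintegral_mulr_zero_mean_part len0 wtheta th supph h1 intA).
rewrite (space_mean_pairing alpha0 r0 inta weta tpsi).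
apply: tensor_pairing_le dphi phi_le psi_le _ tpsi inta => //.
by rewrite addr_gt0.
Qed.

Lemma NQ_dt_ge0 : (0 <= NQ_dt alpha r t0 x0 a)%E.
Proof.
have coef0 : (0 < (5 * alpha * r * (1 + c') * c * vol / V)%:E)%E.
  by rewrite lte_fin divr_gt0// !mulr_gt0// addr_gt0.
rewrite -(pmule_rge0 _ coef0); apply: le_trans time_estimate.
by apply: integral_ge0 => t _; rewrite lee_fin.
Qed.

Lemma time_estimate_pcyl (C := \int[leb R 0]_(t in I) (A t * theta t)) :
  (\int[mu]_(z in Q) (`|A (z.1 : R) - C|)%:E <=
   (5 * (1 + c') * c * (alpha * r * vol))%:E * NQ_dt alpha r t0 x0 a)%E.
Proof.
rewrite (integral_pcyl_time t0 x0 alpha0 r0 (f := fun t => `|A t - C|))//; last first.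
  apply: measurableT_comp => //; apply: measurable_funB => //.
  exact: (measurable_space_mean alpha0 r0 inta weta).
apply: le_trans (lee_wpmul2l _ time_estimate) _; first by rewrite lee_fin ltW.
rewrite muleA -EFinM le_eqVlt; apply: predU1l; congr (_%:E * _)%E.
by rewrite -/V; field; rewrite gt_eqF.
Qed.

End time_estimate.

(** * The Poincare inequality *)

Section weighted_mean.
Context {R : realType} d (T : measurableType d) (mu : {measure set T -> \bar R}).
Variables (D : set T) (mD : measurable D) (vol c0 : R).
Hypotheses (vol0 : 0 < vol) (volE : mu D = vol%:E).
Variables (a rho : T -> R).
Hypotheses (inta : mu.-integrable D (EFin \o a)) (intrho : mu.-integrable D (EFin \o rho)).
Hypothesis rho0 : forall z, D z -> 0 <= rho z.
Let P : R := \int[mu]_(z in D) rho z.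
Hypothesis P0 : 0 < P.
Hypothesis rho_le : {ae mu, forall z, D z -> rho z <= c0 / vol * P}.
Let K : R := `|c0| / vol * P.

Let K0 : 0 <= K.
Proof. by rewrite !mulr_ge0 ?invr_ge0// ltW. Qed.

Let integrable_cst (C : R) : mu.-integrable D (EFin \o cst C).
Proof.
apply: measurable_bounded_integrable => //; first by rewrite volE ltry.
exact: bounded_cst.
Qed.

Let integrableB_cst (C : R) : mu.-integrable D (EFin \o (fun z => a z - C)).
Proof. exact: (integrableB mD inta (integrable_cst C)). Qed.

Lemma integral_normr_weighted_le (f : T -> R) : measurable_fun D f ->
  (\int[mu]_(z in D) (`|f z * rho z|)%:E <= K%:E * \int[mu]_(z in D) (`|f z|)%:E)%E.
Proof.
move=> mf; have mrho := integrable_measurable_fun intrho.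
rewrite -ge0_integralZl//; last by apply/measurable_EFinP; exact: measurableT_comp.
apply: ae_ge0_le_integral => //.
- by apply/measurable_EFinP/measurableT_comp => //; exact: measurable_funM.
- by move=> z _; rewrite -EFinM lee_fin mulr_ge0.
- by apply: measurable_funeM; apply/measurable_EFinP; exact: measurableT_comp.
move: rho_le; apply: filterS => z rho_z Dz.
rewrite -EFinM lee_fin normrM mulrC ler_wpM2r// ger0_norm ?rho0//.
apply: le_trans (rho_z Dz) _; rewrite /K -!mulrA ler_wpM2r ?ler_norm//.
by rewrite mulr_ge0 ?invr_ge0// ltW.
Qed.

Lemma integrable_weighted (f : T -> R) : mu.-integrable D (EFin \o f) ->
  mu.-integrable D (EFin \o (fun z => f z * rho z)).
Proof.
move=> intf; have mf := integrable_measurable_fun intf.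
have mrho := integrable_measurable_fun intrho.
apply/integrableP; split; first by apply/measurable_EFinP; exact: measurable_funM.
apply: le_lt_trans (integral_normr_weighted_le mf) _.
by have /integrableP[_ f_fin] := intf; rewrite lte_mul_pinfty.
Qed.

Lemma weighted_mean_dist_le (C : R) :
  `|(\int[mu]_(z in D) (a z * rho z)) / P - C| <=
  `|c0| / vol * \int[mu]_(z in D) `|a z - C|.
Proof.
have intaC := integrableB_cst C.
have -> : (\int[mu]_(z in D) (a z * rho z)) / P - C =
    (\int[mu]_(z in D) ((a z - C) * rho z)) / P.
  rewrite [in RHS](_ : \int[mu]_(z in D) _ = \int[mu]_(z in D) (a z * rho z) - C * P).
    by rewrite mulrBl mulfK// gt_eqF.
  rewrite -RintegralZl// -RintegralB//; last exact: (integrableZl mD C intrho).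
    by apply: eq_Rintegral => z _; rewrite mulrBl.
  exact: integrable_weighted.
rewrite normrM normfV (gtr0_norm P0) ler_pdivrMr// mulrAC -/K -lee_fin EFinM.
rewrite -(fineK_integral mD (integrable_abse intaC)).
rewrite EFin_normr_Rintegral//; last exact: integrable_weighted.
apply: le_trans (integral_normr_weighted_le (integrable_measurable_fun intaC)).
apply: le_abse_integral => //; exact: (measurable_int _ (integrable_weighted intaC)).
Qed.

Lemma integral_weighted_mean_dist_le (C : R) :
  (\int[mu]_(z in D) (`|a z - (\int[mu]_(z in D) (a z * rho z)) / P|)%:E <=
   (1 + `|c0|)%:E * \int[mu]_(z in D) (`|a z - C|)%:E)%E.
Proof.
set W := _ / P; have intW := integrableB_cst W; have intC := integrableB_cst C.
rewrite (fineK_integral mD (integrable_abse intW)) (fineK_integral mD (integrable_abse intC)).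
rewrite -EFinM lee_fin.
apply: le_trans (_ : \int[mu]_(z in D) (`|a z - C| + cst `|W - C| z) <= _).
  apply: le_Rintegral => //; first exact: integrable_abse intW.
    exact: (integrableD mD (integrable_abse intC) (integrable_cst _)).
  move=> z _; rewrite /= (distrC W) (_ : a z - W = (a z - C) + (C - W)); last by ring.
  exact: ler_normD.
rewrite (RintegralD mD (integrable_abse intC) (integrable_cst _)) Rintegral_cst// volE/=.
rewrite mulrDl mul1r lerD2l -ler_pdivlMr// mulrAC.
exact: weighted_mean_dist_le.
Qed.

End weighted_mean.

Lemma mean_oscillation_le (R : realType) (k : nat) : exists2 K : R, 0 < K &
  forall (alpha r t0 : R) (x0 : car R k) (a : car R k.+1 -> R) (g : car R k.+1 -> car R k),
  0 < alpha -> 0 < r ->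
  let Q := pcyl alpha r t0 x0 in
  (leb R k.+1).-integrable Q (EFin \o a) -> weak_gradx Q a g ->
  exists C : R, (\int[leb R k.+1]_(z in Q) (`|a z - C|)%:E <=
    (K * r)%:E * (\int[leb R k.+1]_(z in Q) (enorm (g z))%:E +
                  (alpha * volQ alpha r t0 x0)%:E * NQ_dt alpha r t0 x0 a))%E.
Proof.
have [c c0 space_weight] := @ball_weight_exists R k.
have [c' c'0 time_weight] := @ball_weight_exists R 0.
pose K1 := c * 2 ^+ k.+2; pose K2 := 5 * (1 + c') * c.
have K10 : 0 < K1 by rewrite mulr_gt0// exprn_gt0.
have K20 : 0 < K2 by rewrite !mulr_gt0// addr_gt0.
exists (K1 + K2); first exact: addr_gt0.
move=> alpha r t0 x0 a g alpha0 r0 Q inta wg.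
have len0 : 0 < alpha * r ^+ 2 by rewrite mulr_gt0// exprn_gt0.
have [eta weta] := space_weight x0 r r0.
have [theta wtheta] := time_weight t0 _ len0.
have mQ : measurable Q := measurable_pcyl t0 x0 alpha0 r0.
have vol0 := volQ_gt0 t0 x0 alpha0 r0.
pose A := space_mean alpha r t0 x0 a eta.
pose C := \int[leb R 0]_(t in eball (t0 : car R 0) (alpha * r ^+ 2)) (A t * theta t).
have intG := integrable_enorm_grad wg.
have G0 : 0 <= \int[leb R k.+1]_(z in Q) enorm (g z).
  by apply: Rintegral_ge0 => z _; exact: enorm_ge0.
have N0 : (0 <= NQ_dt alpha r t0 x0 a)%E := NQ_dt_ge0 alpha0 r0 c0 weta inta c'0 wtheta.
have mA := measurable_space_mean alpha0 r0 inta weta.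
exists C.
apply: le_trans (integral_dist_triangle (leb R k.+1) mQ (g := fun z => A (z.1 : R)) _ _ _) _.
- exact: integrable_measurable_fun inta.
- by apply: measurable_funTS; exact: (measurableT_comp mA measurable_fst).
- exact: measurable_cst.
rewrite (fineK_integral mQ intG).
rewrite ge0_muleDr ?lee_fin ?mule_ge0 ?lee_fin ?mulr_ge0 ?(ltW alpha0) ?(ltW vol0)//.
rewrite -EFinM muleA -EFinM; apply: leeD.
  apply: le_trans (space_mean_close alpha0 r0 inta weta wg) _.
  by rewrite lee_fin -/K1 ler_wpM2r// ler_wpM2r ?(ltW r0)// lerDl ltW.
apply: le_trans (time_estimate_pcyl alpha0 r0 c0 weta inta c'0 wtheta) _.
rewrite -/K2 lee_wpmul2r// lee_fin.
rewrite (_ : (K1 + K2) * r * _ = (K1 + K2) * (alpha * r * volQ alpha r t0 x0)); last by ring.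
by rewrite ler_wpM2r ?lerDr ?(ltW K10)// !mulr_ge0// ltW.
Qed.

Theorem theorem2p8 (R : realType) (k : nat) (c0 : R) :
  exists c : R, 0 < c /\
  forall (alpha r t0 : R) (x0 : car R k)
         (rho a : car R k.+1 -> R) (g : car R k.+1 -> car R k),
    0 < alpha -> 0 < r ->
    let Q := pcyl alpha r t0 x0 in
    let mu := leb R k.+1 in
    (* rho in L^1(Q), rho >= 0, rho not a.e. zero *)
    measurable_fun Q rho ->
    mu.-integrable Q (fun z => (rho z)%:E) ->
    (forall z, Q z -> 0 <= rho z) ->
    (0 < \int[mu]_(z in Q) (rho z)%:E)%E ->
    (* ||rho||_oo <= c0 |Q|^-1 ||rho||_1 *)
    {ae mu, forall z, Q z ->
       rho z <= c0 / volQ alpha r t0 x0 * fine (\int[mu]_(z in Q) (rho z)%:E)} ->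
    (* a in L^1(I; W^{1,1}(B)): a in L^1(Q) with spatial weak gradient g in L^1(Q) *)
    measurable_fun Q a ->
    mu.-integrable Q (fun z => (a z)%:E) ->
    weak_gradx Q a g ->
    ((volQ alpha r t0 x0)^-1%:E *
       \int[mu]_(z in Q) (`|(a z - wmean Q rho a) / r|)%:E
     <= (c / volQ alpha r t0 x0)%:E * \int[mu]_(z in Q) (enorm (g z))%:E
        + (c * alpha)%:E * NQ_dt alpha r t0 x0 a)%E.
Proof.
have [K K0 mean_osc] := mean_oscillation_le R k.
have c00 : 0 < 1 + `|c0| by rewrite ltr_wpDr.
exists ((1 + `|c0|) * K); split; first exact: mulr_gt0.
move=> alpha r t0 x0 rho a g alpha0 r0 Q mu _ intrho rho0 rho_gt0 rho_le ma inta wg.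
have mQ : measurable Q := measurable_pcyl t0 x0 alpha0 r0.
have vol0 := volQ_gt0 t0 x0 alpha0 r0.
have volE : mu Q = (volQ alpha r t0 x0)%:E := leb_pcyl t0 x0 alpha0 r0.
have P0 : 0 < \int[mu]_(z in Q) rho z by rewrite -lte_fin -(fineK_integral mQ intrho).
have [C osc_le] := mean_osc alpha r t0 x0 a g alpha0 r0 inta wg.
have weighted_le := integral_weighted_mean_dist_le mQ vol0 volE inta intrho rho0 P0 rho_le C.
under eq_integral => z _ do rewrite normrM [`|r^-1|]gtr0_norm ?invr_gt0// mulrC EFinM.
rewrite ge0_integralZl ?lee_fin ?invr_ge0 ?(ltW r0)//; last first.
  by apply/measurable_EFinP/measurableT_comp => //; exact: measurable_funB.
apply: le_trans (lee_wpmul2l _ (lee_wpmul2l _ (le_trans weighted_le (lee_wpmul2l _ osc_le)))) _.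
1-3: by rewrite lee_fin ?invr_ge0 ltW.
rewrite (fineK_integral mQ (integrable_enorm_grad wg)) !muleA -!EFinM.
rewrite muleDr ?fin_num_adde_defr// muleA -!EFinM le_eqVlt; apply: predU1l.
by congr (_%:E + _%:E * _)%E; field; rewrite !gt_eqF.
Qed.
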